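(* Let $B=\{B_s\}_{s\ge 0}$ be a one-dimensional standard Brownian motion and fix $t>0$. Then \[ \{\mathcal{T}(B)(s)\}_{0\le s\le t}\ \stackrel{(d)}{=}\ \{B_s\}_{0\le s\le t}, \] where explicitly \[ \mathcal{T}(B)(s)=B_s-\log\Bigl\{1+\frac{A_s}{A_t}\bigl(e^{2B_t}-1\bigr)\Bigr\},\qquad A_s=\int_0^s e^{2B_u}\,du . \]
   Context: For $\phi\in C([0,t];\mathbb{R})$ let $A_s(\phi)=\int_0^s e^{2\phi_u}\,du$. For $z\in\mathbb{R}$ define the path transformation $\mathbb{T}_z=\mathbb{T}^t_z$ on $C([0,t];\mathbb{R})$ by $\mathbb{T}_z(\phi)(s)=\phi_s-\log\{1+\frac{A_s(\phi)}{A_t(\phi)}(e^z-1)\}$, $0\le s\le t$, and define $\mathcal{T}=\mathcal{T}^t$ by $\mathcal{T}(\phi)(s)=\mathbb{T}_{2\phi_t}(\phi)(s)$, $0\le s\le t$. $\stackrel{(d)}{=}$ denotes equality in law (of processes). *)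

(* Defs.v *)
From HB Require Import structures.
From mathcomp Require Import all_boot all_order all_algebra.
From mathcomp Require Import all_classical all_reals all_analysis.
Set Implicit Arguments. Unset Strict Implicit. Unset Printing Implicit Defensive.
Import Order.TTheory GRing.Theory Num.Theory.
Import numFieldNormedType.Exports.
Local Open Scope classical_set_scope.
Local Open Scope ring_scope.

Section Defs.
Context {R : realType}.

Definition Apath (phi : R -> R) (s : R) : R :=
  Rintegral lebesgue_measure `[0, s] (fun u => expR (2 * phi u)).

Definition Tz (t z : R) (phi : R -> R) (s : R) : R :=
  phi s - ln (1 + Apath phi s / Apath phi t * (expR z - 1)).

Definition calT (t : R) (phi : R -> R) (s : R) : R := Tz t (2 * phi t) phi s.

Context {d : measure_display} {Omega : measurableType d}.

(* Standard one-dimensional Brownian motion on (Omega, P), indexed by s >= 0: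
   measurable coordinates, B_0 = 0, continuous paths on [0,+oo), and for
   0 <= t_0 < t_1 < ... < t_n the increments B_{t_{i+1}} - B_{t_i} are
   independent with law N(0, t_{i+1} - t_i) (normal_prob takes the standard
   deviation). *)
Definition is_brownian_motion (P : probability Omega R) (B : R -> Omega -> R) : Prop :=
  [/\ (forall s, 0 <= s -> measurable_fun setT (B s)),
      (forall w, B 0 w = 0),
      (forall w, {within `[0, +oo[, continuous (fun s => B s w)})
    & (forall (n : nat) (ts : nat -> R) (A : nat -> set R),
        0 <= ts 0%N ->
        (forall i, (i < n)%N -> ts i < ts i.+1) ->
        (forall i, measurable (A i)) ->
        P (\bigcap_(i in `I_n) [set w | A i (B (ts i.+1) w - B (ts i) w)]) =
        (\prod_(i < n) fine (normal_prob 0 (Num.sqrt (ts i.+1 - ts i)) (A i)))%:E)].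

(* Equality in law of two processes indexed by [0, t]: equality of all
   finite-dimensional distributions (tested on measurable rectangles, which
   form a pi-system generating the product sigma-algebra). *)
Definition eq_law_on (P : probability Omega R) (t : R) (X Y : R -> Omega -> R) : Prop :=
  forall (n : nat) (ss : nat -> R) (A : nat -> set R),
    (forall i, (i < n)%N -> 0 <= ss i <= t) ->
    (forall i, measurable (A i)) ->
    P (\bigcap_(i in `I_n) [set w | A i (X (ss i) w)]) =
    P (\bigcap_(i in `I_n) [set w | A i (Y (ss i) w)]).

End Defs.

(* Main.v *)
(** The transformation has an exact discrete analogue. Along a random walk with
    step h whose increments have density proportional to exp (- cosh u / h), put
    A_(k+1) = A_k + h exp (x_k + x_(k+1)) and Z_k = A_k exp (- x_k). In the
    coordinates (Z_2, ..., Z_n, x_n) the law of the walk is a function of Z times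
    exp (- cosh x_n / Z_n), an even function of the endpoint x_n. Hence the map
    keeping Z and changing the sign of x_n preserves the law; on paths it reads
    x_k |-> x_k - ln (1 + A_k / A_n (exp (2 x_n) - 1)).

    Those increments have density exp (- Y) with respect to N(0, h), up to a
    constant, where Y u = (cosh u - 1 - u^2 / 2) / h = O(h) in L^2. So on the n = t / h
    increments of Brownian motion the normalized density has variance O(h), and the
    discrete map preserves the Brownian expectations of [0, 1]-valued functionals up
    to an error tending to 0. Finally the discrete map converges pathwise to calT. *)

Require Import Defs.
From HB Require Import structures.
From mathcomp Require Import all_boot all_order all_algebra.
From mathcomp Require Import all_classical all_reals all_analysis.
From mathcomp Require Import measurable_realfun normal_distribution ring lra.
Import Order.TTheory GRing.Theory Num.Theory.
Import numFieldNormedType.Exports.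
Local Open Scope classical_set_scope.
Local Open Scope ring_scope.

(** * Invariances of Lebesgue measure, and iterated integrals over lists *)

Section IteratedIntegral.
Context {R : realType}.
Notation mu := (@lebesgue_measure R).

(** The same mechanism is at work in continuous time: [calT] keeps Z_s = A_s exp (- B_s), and given
    this process up to t the endpoint has a density proportional to exp (- cosh x / Z_t). A direct
    proof of that would need conditional laws given a path and stochastic calculus. For the cosh
    walk it is a factorization of an explicit density, checked by [field], and the change of
    coordinates uses only Tonelli and translations. The density of the cosh walk with respect to the
    Gaussian one does not tend to 1 before normalization: a factor has mean 1 - h / 8 to first
    order, and t / h of them multiply to about exp (- t / 8). The density is therefore compared with
    its own mean, and only its relative variance has to be small. *)

Lemma pushforward_lebesgue_measureD (a : R) (A : set R) : measurable A ->
  pushforward mu ((fun x => x + a) : measurableTypeR R -> measurableTypeR R) A = mu A.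
Proof.
move=> mA; apply/esym/lebesgue_measure_unique => //=; first exact: measurable_funD.
move=> ? _ [[b c]] _ <-; rewrite /pushforward.
rewrite (_ : _ @^-1` _ = `]b - a, c - a]%classic); last first.
  by apply/seteqP; split => x /=; rewrite !in_itv/= ltrBlDr lerBrDr.
rewrite !lebesgue_measure_itv/= !lte_fin ltrD2r; case: ifP => // _.
by congr (_%:E); lra.
Qed.

Lemma integral_translate (f : R -> \bar R) (a : R) :
  measurable_fun setT f -> (forall x, 0 <= f x)%E ->
  (\int[mu]_x f (x + a)%R = \int[mu]_x f x)%E.
Proof.
move=> mf f0.
have mD : measurable_fun setT ((fun x => x + a) : measurableTypeR R -> measurableTypeR R).
  exact: measurable_funD.
transitivity (\int[pushforward mu ((fun x => x + a)%R : measurableTypeR R -> measurableTypeR R)]_x f x)%E.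
  by rewrite (ge0_integral_pushforward mD).
by apply: eq_measure_integral => A mA _; exact: pushforward_lebesgue_measureD.
Qed.

Lemma integral_reflect (f : R -> \bar R) :
  measurable_fun setT f -> (forall x, 0 <= f x)%E ->
  (\int[mu]_x f (- x)%R = \int[mu]_x f x)%E.
Proof.
move=> mf f0.
have mN : measurable_fun setT (-%R : measurableTypeR R -> measurableTypeR R) by [].
transitivity (\int[pushforward mu (-%R : measurableTypeR R -> measurableTypeR R)]_x f x)%E.
  by rewrite (ge0_integral_pushforward mN).
by apply: eq_measure_integral => A mA _; exact: lebesgue_measureN.
Qed.

(* Lists of reals carry no sigma-algebra here: a function of n-element lists is
   called measurable when all its compositions with n measurable coordinates are. *)
Definition mseq {d} {T : measurableType d} (n : nat) (s : T -> seq R) :=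
  (forall w, size (s w) = n) /\
  (forall i, measurable_fun setT (fun w => nth 0 (s w) i)).

Definition seqmeas {d'} {E : measurableType d'} (n : nat) (F : seq R -> E) :=
  forall d (T : measurableType d) (s : T -> seq R),
    mseq n s -> measurable_fun setT (F \o s).

Lemma mseq_nil d (T : measurableType d) : mseq 0 (fun _ : T => [::]).
Proof. by split => // i; under eq_fun do rewrite nth_nil; exact: measurable_cst. Qed.

Lemma mseq_cons d (T : measurableType d) n (f : T -> R) (s : T -> seq R) :
  measurable_fun setT f -> mseq n s -> mseq n.+1 (fun w => f w :: s w).
Proof. by move=> mf [ss ms]; split => [w|[|i]] //=; rewrite ss. Qed.

Lemma mseq_comp d d' (T : measurableType d) (T' : measurableType d') n
  (g : T' -> T) (s : T -> seq R) :
  measurable_fun setT g -> mseq n s -> mseq n (s \o g).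
Proof.
move=> mg [ss ms]; split => [w|i]; first exact: ss.
exact: (measurableT_comp (ms i) mg).
Qed.

Lemma mseq_head d (T : measurableType d) n (s : T -> seq R) :
  mseq n s -> measurable_fun setT (fun w => head 0 (s w)).
Proof. by case=> _ /(_ 0%N); under eq_fun do rewrite nth0. Qed.

Lemma mseq_behead d (T : measurableType d) n (s : T -> seq R) :
  mseq n.+1 s -> mseq n (fun w => behead (s w)).
Proof.
case=> ss ms; split => [w|i]; first by rewrite size_behead ss.
by under eq_fun do rewrite nth_behead; exact: ms.
Qed.

Lemma mseq_head_behead d (T : measurableType d) n (s : T -> seq R) :
  mseq n.+1 s -> s = (fun w => head 0 (s w) :: behead (s w)).
Proof. by case=> ss _; apply/funext => w; have := ss w; case: (s w). Qed.

Lemma mseq_cst d (T : measurableType d) n (v : seq R) :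
  size v = n -> mseq n (fun _ : T => v).
Proof. by move=> sv; split => // i; exact: measurable_cst. Qed.

Lemma seqmeas_cons d' (E : measurableType d') n (F : seq R -> E) v :
  seqmeas n.+1 F -> size v = n -> measurable_fun setT (fun u : R => F (u :: v)).
Proof.
move=> mF sv; apply: (mF _ _ (fun u : R => u :: v)).
by apply: mseq_cons => //; exact: mseq_cst.
Qed.

(** The head of the list is the innermost variable. As walks list their latest increment first,
    peeling off one integral isolates the last step with the past held fixed. *)
Fixpoint iter_int (g : R -> R) (n : nat) (F : seq R -> \bar R) : \bar R :=
  if n is n'.+1 then
    iter_int g n' (fun v => \int[mu]_u (F (u :: v) * (g u)%:E))%E
  else F [::].

Lemma eq_iter_int (g : R -> R) n (F G : seq R -> \bar R) :
  (forall v, size v = n -> F v = G v) -> iter_int g n F = iter_int g n G.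
Proof.
elim: n F G => [|n ih] F G FG /=; first exact: FG.
apply: ih => v sv; apply: eq_integral => u _.
by rewrite FG//= sv.
Qed.

Lemma seqmeas_integral (g : R -> R) n (F : seq R -> \bar R) :
  measurable_fun setT g -> (forall u, 0 <= g u) -> (forall v, 0 <= F v)%E ->
  seqmeas n.+1 F ->
  seqmeas n (fun v => \int[mu]_u (F (u :: v) * (g u)%:E))%E.
Proof.
move=> mg g0 F0 mF d T s ms.
pose f (z : T * R) := (F (z.2 :: s z.1) * (g z.2)%:E)%E.
apply: (@measurable_fun_fubini_tonelli_F _ _ _ _ _ mu f); last first.
  by move=> z; rewrite mule_ge0// lee_fin.
apply: emeasurable_funM.
  apply: (mF _ _ (fun z : T * R => z.2 :: s z.1)); apply: mseq_cons => //.
  exact: (mseq_comp _ _ _ _ _ fst s).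
by apply/measurable_EFinP; exact: measurableT_comp.
Qed.

(** A product density passes into the one-step weight, one variable at a time; this is how
    reweighted Gaussian increments become cosh increments. *)
Lemma iter_int_density (g k : R -> R) n (F : seq R -> \bar R) :
  measurable_fun setT g -> (forall u, 0 <= g u) ->
  measurable_fun setT k -> (forall u, 0 <= k u) ->
  (forall v, 0 <= F v)%E -> seqmeas n F ->
  iter_int g n (fun v => F v * (\prod_(u <- v) k u)%:E)%E =
  iter_int (fun u => k u * g u) n F.
Proof.
move=> mg g0 mk k0; elim: n F => [|n ih] F F0 mF /=.
  by rewrite big_nil mule1.
rewrite -ih.
- apply: eq_iter_int => v sv.
  rewrite -ge0_integralZr//.
  + apply: eq_integral => u _; rewrite big_cons -!muleA -!EFinM.
    by congr (_ * _%:E)%E; ring.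
  + apply: emeasurable_funM; last exact/measurable_EFinP/measurable_funM.
    exact: seqmeas_cons mF sv.
  + by move=> u _; rewrite mule_ge0// lee_fin mulr_ge0.
  + by rewrite lee_fin prodr_ge0.
- by move=> v; apply: integral_ge0 => u _; rewrite mule_ge0// lee_fin mulr_ge0.
- apply: seqmeas_integral => //; first exact: measurable_funM.
  by move=> u; rewrite mulr_ge0.
Qed.

Lemma iter_intZl (g : R -> R) n (F : seq R -> \bar R) (c : R) :
  measurable_fun setT g -> (forall u, 0 <= g u) -> 0 <= c ->
  (forall v, 0 <= F v)%E -> seqmeas n F ->
  iter_int g n (fun v => c%:E * F v)%E = (c%:E * iter_int g n F)%E.
Proof.
move=> mg g0 c0; elim: n F => [|n ih] F F0 mF //=.
rewrite -ih//; last 2 first.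
- by move=> v; apply: integral_ge0 => u _; rewrite mule_ge0// lee_fin.
- exact: seqmeas_integral.
apply: eq_iter_int => v sv; under eq_integral => u _ do rewrite -muleA.
rewrite ge0_integralZl//.
- apply: emeasurable_funM; last exact/measurable_EFinP.
  exact: seqmeas_cons mF sv.
- by move=> u _; rewrite mule_ge0// lee_fin.
Qed.

End IteratedIntegral.

(** * Measurability of exponentials, logarithms and cosh *)

Section MeasurableExpLn.
Context {R : realType} {d : measure_display} {T : measurableType d}.
Implicit Types f : T -> R.

Lemma measurable_fun_expR f :
  measurable_fun setT f -> measurable_fun setT (fun w => expR (f w)).
Proof. by move=> mf; exact: (measurableT_comp (@measurable_expR R) mf). Qed.

Lemma measurable_fun_ln f :
  measurable_fun setT f -> measurable_fun setT (fun w => ln (f w)).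
Proof. by move=> mf; exact: (measurableT_comp (@measurable_ln R) mf). Qed.

End MeasurableExpLn.

Section Cosh.
Context {R : realType}.
Implicit Types x : R.

Definition ch x : R := (expR x + expR (- x)) / 2.

Lemma chN x : ch (- x) = ch x.
Proof. by rewrite /ch opprK addrC. Qed.

Lemma measurable_ch : measurable_fun setT ch.
Proof.
apply: measurable_funM => //; apply: measurable_funD.
  exact: measurable_expR.
exact: measurable_fun_expR.
Qed.

End Cosh.

(** * The cosh walk in the coordinates (Z, endpoint) *)

Section DiscreteWalk.
Context {R : realType} (h : R) (h0 : 0 < h).
Notation mu := (@lebesgue_measure R).
Implicit Types (u y z c : R) (v l : seq R).

Definition walk_weight u : R := expR (- (ch u / h)).

(* A walk is coded by the list of its increments, the latest one first. *)
Definition pos v : R := \sum_(u <- v) u.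

(** The exponent is x_k + x_(k+1), so a step contributes h times the geometric mean of exp (2 x) at
    its two ends. This choice gives the recursion Z_(k+1) = exp (x_k) (Z_k exp (- x_(k+1)) + h). *)
Fixpoint area v : R :=
  if v is u :: v' then area v' + h * expR (2 * pos v' + u) else 0.

(* The list l holds ln Z_n, ..., ln Z_2; the value Z_1 = h is not recorded. *)
Definition zlast l : R := expR (head (ln h) l).

(** Solves exp z = exp p ([zlast l] exp (- y) + h) for p: the recursion of Z over a step from p to
    y. *)
Definition prev_pos l z y : R := z - ln (zlast l * expR (- y) + h).

Fixpoint path_of l y : seq R :=
  if l is z :: l' then (y - prev_pos l' z y) :: path_of l' (prev_pos l' z y)
  else [:: y].

Definition zkernel l z : R :=
  expR (- ((zlast l ^+ 2 + h ^+ 2) / (2 * h * zlast l) * expR (- z)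
           + expR z / (2 * h * zlast l))).

Fixpoint zweight l : R :=
  if l is z :: l' then zweight l' * zkernel l' z else 1.

(** Unnormalized conditional law of the endpoint given Z; in the variable exp y it is a generalized
    inverse Gaussian law of index 0. *)
Definition end_weight l y : R := expR (- (ch y / zlast l)).

Lemma measurable_walk_weight : measurable_fun setT walk_weight.
Proof.
apply: measurable_fun_expR; apply: measurableT_comp => //.
by apply: measurable_funM => //; exact: measurable_ch.
Qed.

Lemma measurable_end_weight l : measurable_fun setT (end_weight l).
Proof.
apply: measurable_fun_expR; apply: measurableT_comp => //.
by apply: measurable_funM => //; exact: measurable_ch.
Qed.

Lemma zlast_gt0 l : 0 < zlast l. Proof. exact: expR_gt0. Qed.

Lemma zweight_ge0 l : 0 <= zweight l.
Proof. by elim: l => //= z l ih; rewrite mulr_ge0// expR_ge0. Qed.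

Lemma zlast_denom_gt0 l y : 0 < zlast l * expR (- y) + h.
Proof. by rewrite addr_gt0// mulr_gt0 ?expR_gt0. Qed.

Lemma expR_prev_pos l z y :
  expR (prev_pos l z y) = expR z / (zlast l * expR (- y) + h).
Proof. by rewrite /prev_pos expRD expRN lnK// posrE zlast_denom_gt0. Qed.

(** Up to sign, the exponent on the left is a combination of exp p and exp (- p). The coefficient of
    exp p cancels the denominator in [expR_prev_pos] and leaves a term free of y; the part with exp
    (- p) expands into a term free of y plus cosh y / exp z. *)
Lemma walk_weight_end_weight l z y :
  walk_weight (y - prev_pos l z y) * end_weight l (prev_pos l z y) =
  zkernel l z * end_weight (z :: l) y.
Proof.
have := expR_prev_pos l z y; move: (prev_pos l z y) => p Ep.
rewrite /walk_weight /end_weight /zkernel -!expRD; congr expR.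
rewrite -[zlast (z :: l)]/(expR z) /ch opprB !expRD !expRN Ep.
have := zlast_denom_gt0 l y; rewrite expRN.
move: (zlast l) (expR y) (expR z) (zlast_gt0 l) (expR_gt0 y) (expR_gt0 z).
move=> Z Y W Z0 Y0 W0 D0; field.
by rewrite !gt_eqF// addr_gt0// mulr_gt0.
Qed.

Lemma measurable_prev_pos d (T : measurableType d) l (f g : T -> R) :
  measurable_fun setT f -> measurable_fun setT g ->
  measurable_fun setT (fun w => prev_pos l (f w) (g w)).
Proof.
move=> mf mg; apply: measurable_funB => //.
apply: measurable_fun_ln; apply: measurable_funD => //.
apply: measurable_funM => //; apply: measurable_fun_expR.
exact: measurableT_comp.
Qed.

Lemma mseq_path_of d (T : measurableType d) l (f : T -> R) :
  measurable_fun setT f -> mseq (size l).+1 (fun w => path_of l (f w)).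
Proof.
elim: l f => [|z l ih] f mf /=.
  by apply: mseq_cons => //; exact: mseq_nil.
have mp := measurable_prev_pos _ _ l _ _ (measurable_cst z) mf.
by apply: mseq_cons; [exact: measurable_funB|exact: ih].
Qed.

(** The substitutions u = y - y' at fixed y' and y' = [prev_pos l z y] at fixed y trade (u, y') for
    (z, y). Each is a translation, because [prev_pos l z y] is z minus a function of y. Hence no
    Jacobian appears, which is the reason for recording ln Z instead of Z. *)
Lemma integral_last_step l (Phi : R * R -> \bar R) :
  measurable_fun setT Phi -> (forall x, 0 <= Phi x)%E ->
  (\int[mu]_y' ((\int[mu]_u (Phi (u, y') * (walk_weight u)%:E))
     * (end_weight l y')%:E) =
  \int[mu]_z ((zkernel l z)%:E *
     \int[mu]_y (Phi ((y - prev_pos l z y)%R, prev_pos l z y)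
       * (end_weight (z :: l) y)%:E)))%E.
Proof.
move=> mPhi Phi0.
have mw := measurable_walk_weight; have me := measurable_end_weight.
pose H (x : R * R) := (Phi ((x.1 - x.2)%R, x.2) *
  (walk_weight (x.1 - x.2) * end_weight l x.2)%:E)%E.
have H0 x : (0 <= H x)%E by rewrite mule_ge0// lee_fin mulr_ge0 ?expR_ge0.
have mB : measurable_fun setT (fun x : R * R => x.1 - x.2) by exact: measurable_funB.
have mH : measurable_fun setT H.
  apply: emeasurable_funM.
    by apply: (measurableT_comp mPhi); exact: measurable_fun_pair.
  apply/measurable_EFinP; apply: measurable_funM.
    exact: (measurableT_comp mw).
  by apply: (measurableT_comp (me l)).
transitivity (\int[mu]_y' \int[mu]_y H (y, y'))%E.
  apply: eq_integral => y' _.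
  have mf : measurable_fun setT (fun u : R => Phi (u, y') * (walk_weight u)%:E)%E.
    apply: emeasurable_funM; last exact/measurable_EFinP.
    by apply: (measurableT_comp mPhi); exact: measurable_fun_pair.
  rewrite -(integral_translate _ (- y') mf); last first.
    by move=> x; rewrite mule_ge0// lee_fin expR_ge0.
  rewrite -ge0_integralZr//.
  - by apply: eq_integral => y _; rewrite /H/= EFinM muleA.
  - apply: (measurableT_comp mf); exact: measurable_funD.
  - by move=> x _; rewrite mule_ge0// lee_fin expR_ge0.
  - by rewrite lee_fin expR_ge0.
rewrite -(@fubini_tonelli _ _ _ _ _ mu mu H)//.
pose K (x : R * R) := H (x.1, prev_pos l x.2 x.1).
have mK : measurable_fun setT K.
  apply: (measurableT_comp mH); apply: measurable_fun_pair => //.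
  exact: measurable_prev_pos.
transitivity (\int[mu]_y \int[mu]_z K (y, z))%E.
  apply: eq_integral => y _.
  rewrite -(integral_translate (fun x => H (y, x)) (- ln (zlast l * expR (- y) + h)))//.
  by apply: (measurableT_comp mH); exact: measurable_fun_pair.
rewrite (@fubini_tonelli _ _ _ _ _ mu mu K)//; last by move=> x; exact: H0.
apply: eq_integral => z _.
have mf : measurable_fun setT (fun y : R => Phi ((y - prev_pos l z y)%R, prev_pos l z y)
    * (end_weight (z :: l) y)%:E)%E.
  have mp : measurable_fun setT (fun y : R => prev_pos l z y).
    exact: measurable_prev_pos.
  apply: emeasurable_funM; last first.
    apply/measurable_EFinP. exact: (me (z :: l)).
  apply: (measurableT_comp mPhi); apply: measurable_fun_pair => //.
  exact: measurable_funB.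
rewrite -ge0_integralZl//.
- apply: eq_integral => y _; rewrite /K/H/= walk_weight_end_weight.
  by rewrite EFinM muleCA.
- by move=> x _; rewrite mule_ge0// lee_fin expR_ge0.
- by rewrite lee_fin expR_ge0.
Qed.

(** Induction on the number of steps: the hypothesis is applied to the walk without its last step,
    and [integral_last_step] then exchanges that walk's endpoint for the next coordinate z. *)
Lemma iter_int_path n (F : seq R -> \bar R) :
  (forall v, 0 <= F v)%E -> seqmeas n.+1 F ->
  iter_int walk_weight n.+1 F =
  iter_int (cst 1) n (fun l => (zweight l)%:E *
    \int[mu]_y (F (path_of l y) * (end_weight l y)%:E))%E.
Proof.
elim: n F => [|n ih] F F0 mF.
  (* A single increment is its own endpoint, and since Z_1 = h its weight is already [end_weight] of
     the empty list. *)
  rewrite /= mul1e; apply: eq_integral => y _.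
  by rewrite /end_weight /zlast/= lnK.
rewrite -[LHS]/(iter_int walk_weight n.+1 (fun v => \int[mu]_u (F (u :: v) * (walk_weight u)%:E)))%E.
rewrite ih; last 2 first.
- by move=> v; apply: integral_ge0 => u _; rewrite mule_ge0// lee_fin expR_ge0.
- apply: seqmeas_integral => //; [exact: measurable_walk_weight|].
  by move=> u; exact: expR_ge0.
apply: eq_iter_int => l sl /=.
have mPhi : measurable_fun setT (fun x : R * R => F (x.1 :: path_of l x.2)).
  apply: (mF _ _ (fun x : R * R => x.1 :: path_of l x.2)).
  by apply: mseq_cons => //; rewrite -sl; exact: mseq_path_of.
rewrite (integral_last_step l (fun x => F (x.1 :: path_of l x.2)))//.
have mG : measurable_fun setT (fun z : R => (zkernel l z)%:E *
    \int[mu]_y (F (path_of (z :: l) y) * (end_weight (z :: l) y)%:E))%E.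
  apply: emeasurable_funM.
    apply/measurable_EFinP; apply: measurable_fun_expR; apply: measurableT_comp => //.
    apply: measurable_funD; apply: measurable_funM => //; apply: measurable_fun_expR => //.
  pose K (x : R * R) := (F (path_of (x.1 :: l) x.2) * (end_weight (x.1 :: l) x.2)%:E)%E.
  apply: (@measurable_fun_fubini_tonelli_F _ _ _ _ _ mu K); last first.
    by move=> x; rewrite mule_ge0// lee_fin expR_ge0.
  have mp : measurable_fun setT (fun x : R * R => prev_pos l x.1 x.2).
    exact: measurable_prev_pos.
  apply: emeasurable_funM.
    apply: (mF _ _ (fun x : R * R => path_of (x.1 :: l) x.2)).
    apply: mseq_cons; first exact: measurable_funB.
    by rewrite -sl; exact: mseq_path_of.
  apply/measurable_EFinP; apply: measurable_fun_expR; apply: measurableT_comp => //.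
  apply: measurable_funM.
    exact: (measurableT_comp measurable_ch).
  rewrite [X in measurable_fun _ X](_ : _ = fun x => expR (- x.1)); last first.
    by apply/funext => x; rewrite expRN.
  by apply: measurable_fun_expR; exact: measurableT_comp.
rewrite -ge0_integralZl//.
- by apply: eq_integral => z _ /=; rewrite mule1 EFinM muleA.
- move=> z _; rewrite mule_ge0 ?lee_fin ?expR_ge0//.
  by apply: integral_ge0 => y _; rewrite mule_ge0// lee_fin expR_ge0.
- by rewrite lee_fin zweight_ge0.
Qed.

End DiscreteWalk.

(** * The discrete reflection and its exact invariance *)

Section Reflection.
Context {R : realType} (h : R) (h0 : 0 < h).
Notation mu := (@lebesgue_measure R).
Implicit Types (u y z c : R) (v l : seq R).

Lemma pos_cons u v : pos (u :: v) = u + pos v.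
Proof. by rewrite /pos big_cons. Qed.

Lemma area_ge0 v : 0 <= area h v.
Proof. by elim: v => //= u v ih; rewrite addr_ge0// mulr_ge0 ?expR_ge0// ltW. Qed.

(** On positions this is x_k |-> x_k - ln (1 + c A_k). The coefficient c is a parameter because the
    recursion passes to shorter walks while c stays that of the whole walk. *)
Fixpoint rebase c v : seq R :=
  if v is u :: v' then
    (u - ln (1 + c * area h v) + ln (1 + c * area h v')) :: rebase c v'
  else [::].

Definition reflect v : seq R := rebase ((expR (2 * pos v) - 1) / area h v) v.

(** The logarithms telescope down to the empty walk, where the area is 0. *)
Lemma pos_rebase c v : pos (rebase c v) = pos v - ln (1 + c * area h v).
Proof.
elim: v => [|u v ih]; first by rewrite /= mulr0 addr0 ln1 subr0.
by rewrite [rebase _ _]/= !pos_cons ih; lra.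
Qed.

Lemma drop_rebase c k v : drop k (rebase c v) = rebase c (drop k v).
Proof. by elim: v k => [|u v ih] [|k] //=. Qed.

Lemma pos_path l y : pos (path_of h l y) = y.
Proof.
elim: l y => [|z l ih] y; first by rewrite /pos big_seq1.
by rewrite [path_of _ _ _]/= pos_cons ih subrK.
Qed.

Lemma area_path l y : area h (path_of h l y) = zlast h l * expR y.
Proof.
elim: l y => [|z l ih] y.
  by rewrite /= /pos big_nil mulr0 !add0r /zlast/= lnK.
rewrite /= ih pos_path; have := expR_prev_pos h h0 l z y.
move: (prev_pos h l z y) => p Ep.
rewrite (_ : 2 * p + (y - p) = p + y); last by lra.
rewrite expRD -[zlast h (z :: l)]/(expR z) Ep expRN.
have := zlast_denom_gt0 h h0 l y; rewrite expRN.
move: (zlast h l) (expR y) (expR z) (zlast_gt0 h l) (expR_gt0 y) => Z Y W Z0 Y0 D0.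
by field; rewrite !gt_eqF// addr_gt0// mulr_gt0.
Qed.

(** Every admissible c, not just the one of [reflect], keeps all Z and moves only the endpoint. This
    generality carries the induction, since a shorter walk meets a c unrelated to its own
    endpoint. *)
Lemma rebase_path c l y : 0 < 1 + c * (zlast h l * expR y) ->
  rebase c (path_of h l y) =
  path_of h l (y - ln (1 + c * (zlast h l * expR y))).
Proof.
elim: l y => [|z l ih] y c0.
  by rewrite /= /pos big_nil mulr0 !add0r mulr0 addr0 ln1 addr0 /zlast/= lnK.
set L := ln _; have Ep := expR_prev_pos h h0 l z y.
have D0 := zlast_denom_gt0 h h0 l y.
set p := prev_pos h l z y in Ep *; set D := _ + h in D0 Ep.
have EL : expR L = 1 + c * (expR z * expR y) by rewrite lnK.
(* Moving the endpoint by L multiplies the denominator in [prev_pos] by 1 + c A at the previous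
   step, so the previous position moves by exactly what [rebase] prescribes there. *)
have E1 : zlast h l * expR (- (y - L)) + h = D * (1 + c * (zlast h l * expR p)).
  rewrite opprB expRD EL Ep /D; move: D0; rewrite /D expRN.
  move: (zlast h l) (expR y) (expR z) (zlast_gt0 h l) (expR_gt0 y) => Z Y W Z0 Y0 D0.
  by field; rewrite !gt_eqF// addr_gt0// mulr_gt0.
(* Positivity descends to the shorter walk: by E1 this factor is a quotient of two positive
   denominators. *)
have c1 : 0 < 1 + c * (zlast h l * expR p).
  by rewrite -(pmulr_rgt0 _ D0) -E1 zlast_denom_gt0.
have E2 : prev_pos h l z (y - L) = p - ln (1 + c * (zlast h l * expR p)).
  by rewrite {1}/prev_pos E1 lnM ?posrE// /p /prev_pos -/D; lra.
rewrite /= E2 ih// -/p; congr (_ :: _).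
have /= -> := area_path (z :: l) y; rewrite area_path -/L; lra.
Qed.

(** The coefficient in [reflect] is the one for which 1 + c A_n = exp (2 y), so that y goes to y - 2
    y. *)
Lemma reflect_path l y : reflect (path_of h l y) = path_of h l (- y).
Proof.
have ZY : 0 < zlast h l * expR y by rewrite mulr_gt0 ?expR_gt0.
have E : 1 + (expR (2 * y) - 1) / (zlast h l * expR y) * (zlast h l * expR y) = expR (2 * y).
  by rewrite divfK ?gt_eqF// addrC subrK.
rewrite /reflect pos_path area_path rebase_path E ?expR_gt0// expRK.
by congr (path_of _ _ _); lra.
Qed.

Lemma measurable_pos d (T : measurableType d) n (s : T -> seq R) :
  mseq n s -> measurable_fun setT (fun w => pos (s w)).
Proof.
elim: n s => [|n ih] s ms.
  under eq_fun => w do rewrite (size0nil (ms.1 w)); exact: measurable_cst.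
rewrite (mseq_head_behead _ _ _ _ ms); under eq_fun do rewrite pos_cons.
apply: measurable_funD; first exact: mseq_head ms.
by apply: ih; exact: mseq_behead.
Qed.

Lemma measurable_area d (T : measurableType d) n (s : T -> seq R) :
  mseq n s -> measurable_fun setT (fun w => area h (s w)).
Proof.
elim: n s => [|n ih] s ms.
  under eq_fun => w do rewrite (size0nil (ms.1 w)); exact: measurable_cst.
rewrite (mseq_head_behead _ _ _ _ ms) /=.
have mb := mseq_behead _ _ _ _ ms.
apply: measurable_funD; first exact: ih.
apply: measurable_funM => //; apply: measurable_fun_expR.
apply: measurable_funD; last exact: mseq_head ms.
apply: measurable_funM => //; exact: measurable_pos mb.
Qed.

Lemma mseq_rebase d (T : measurableType d) n (f : T -> R) (s : T -> seq R) :
  measurable_fun setT f -> mseq n s -> mseq n (fun w => rebase (f w) (s w)).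
Proof.
move=> mf; elim: n s => [|n ih] s ms.
  under eq_fun => w do rewrite (size0nil (ms.1 w)); exact: mseq_nil.
have mb := mseq_behead _ _ _ _ ms.
have ma := measurable_area _ _ _ _ ms.
rewrite (mseq_head_behead _ _ _ _ ms) in ma *; rewrite /= in ma *.
apply: mseq_cons; last exact: ih.
apply: measurable_funD.
  apply: measurable_funB; first exact: mseq_head ms.
  by apply: measurable_fun_ln; apply: measurable_funD => //; exact: measurable_funM.
apply: measurable_fun_ln; apply: measurable_funD => //; apply: measurable_funM => //.
exact: measurable_area mb.
Qed.

Lemma mseq_reflect d (T : measurableType d) n (s : T -> seq R) :
  mseq n s -> mseq n (fun w => reflect (s w)).
Proof.
move=> ms; apply: mseq_rebase => //; apply: measurable_funM.
  apply: measurable_funB => //; apply: measurable_fun_expR.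
  by apply: measurable_funM => //; exact: measurable_pos ms.
(* The inverse is read as the real power of exponent -1, which is measurable; the rewriting is
   legitimate because areas are nonnegative. *)
under eq_fun do rewrite -powR_inv1 ?area_ge0//.
apply: (measurableT_comp (@measurable_powR R (-1))).
exact: measurable_area ms.
Qed.

Lemma iter_int_reflect n (F : seq R -> \bar R) :
  (forall v, 0 <= F v)%E -> seqmeas n.+1 F ->
  iter_int (walk_weight h) n.+1 (F \o reflect) = iter_int (walk_weight h) n.+1 F.
Proof.
move=> F0 mF.
have mFr : seqmeas n.+1 (F \o reflect).
  by move=> d T s ms; apply: (mF _ _ (reflect \o s)); exact: mseq_reflect.
rewrite !(iter_int_path h h0)//; last by move=> v; exact: F0.
apply: eq_iter_int => l sl; congr (_ * _)%E.
have mf : measurable_fun setT (fun y : R => F (path_of h l y) * (end_weight h l y)%:E)%E.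
  apply: emeasurable_funM.
    by apply: (mF _ _ (path_of h l)); rewrite -sl; exact: mseq_path_of.
  by apply/measurable_EFinP; exact: measurable_end_weight.
rewrite -(integral_reflect _ mf); last first.
  by move=> y; rewrite mule_ge0// lee_fin expR_ge0.
by apply: eq_integral => y _; rewrite /= reflect_path /end_weight chN.
Qed.

End Reflection.

(** * The joint law of independent Gaussian increments *)

Section LawOfIncrements.
Context {R : realType}.
Notation mu := (@lebesgue_measure R).

(** The Radon-Nikodym derivative of the normal law and its explicit density have the same integral
    over every measurable set, hence agree almost everywhere. *)
Lemma ge0_integral_normal_prob (m s : R) (f : R -> \bar R) :
  measurable_fun setT f -> (forall x, 0 <= f x)%E ->
  (\int[normal_prob m s]_x f x = \int[mu]_x (f x * (normal_pdf m s x)%:E))%E.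
Proof.
move=> mf f0; have dom := normal_prob_dominates m s.
rewrite -(Radon_Nikodym_SigmaFinite.change_of_variables dom)//.
have ig := Radon_Nikodym_SigmaFinite.f_integrable dom.
apply: ae_eq_integral => //.
- apply: emeasurable_funM => //; exact: measurable_int ig.
- apply: emeasurable_funM => //; apply/measurable_EFinP.
  exact: measurable_normal_pdf.
- apply: ae_eqe_mul2l; apply: integral_ae_eq => //.
  + by apply/measurable_EFinP; exact: measurable_normal_pdf.
  + by move=> E _ mE; rewrite -Radon_Nikodym_SigmaFinite.f_integral.
Qed.

Context {d : measure_display} {Omega : measurableType d}.
Variables (P : probability Omega R) (xi : nat -> Omega -> R) (s : R).
Hypothesis mxi : forall i, measurable_fun setT (xi i).
Hypothesis indep : forall (n : nat) (A : nat -> set R),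
  (forall i, measurable (A i)) ->
  P (\bigcap_(i in `I_n) [set w | A i (xi i w)]) =
  (\prod_(i < n) fine (normal_prob 0 s (A i)))%:E.

Fixpoint rev_increments (n : nat) (w : Omega) : seq R :=
  if n is m.+1 then xi m w :: rev_increments m w else [::].

Lemma mseq_rev_increments n : mseq n (rev_increments n).
Proof. by elim: n => [|n ih]; [exact: mseq_nil|exact: mseq_cons]. Qed.

Definition rectangles (n : nat) : set (set Omega) :=
  [set X | exists2 A : nat -> set R, (forall i, measurable (A i)) &
    X = \bigcap_(i in `I_n) [set w | A i (xi i w)]].

Lemma measurable_rectangle n X : rectangles n X -> measurable X.
Proof.
case=> A mA ->; apply: bigcap_measurableType => i _.
by rewrite -[X in measurable X]setTI; exact: mxi.
Qed.

Lemma setI_closed_rectangles n : setI_closed (rectangles n).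
Proof.
move=> _ _ [A mA ->] [B mB ->]; exists (fun i => A i `&` B i).
  by move=> i; exact: measurableI.
by rewrite -bigcapI.
Qed.

Lemma rectangles_setT n : rectangles n setT.
Proof. by exists (fun=> setT) => //; apply/seteqP; split. Qed.

(** [Omega] with the sigma-algebra of the first n increments. As a measurable type of its own it can
    be a factor of a product space, which lets independence be stated as an equality with a product
    measure. *)
Notation past n := (g_sigma_algebraType (rectangles n)).

Lemma measurable_past n :
  measurable_fun setT (id : Omega -> past n).
Proof.
apply: (@measurability _ _ _ (past n) _ _ (rectangles n)) => //.
move=> _ [X rX <-]; rewrite setTI; exact: measurable_rectangle rX.
Qed.

Lemma mseq_rev_increments_past n : mseq n (rev_increments n : past n -> seq R).
Proof.
suff: forall k, (k <= n)%N -> mseq k (rev_increments k : past n -> seq R) by exact.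
elim=> [_|k ih kn]; first exact: mseq_nil.
apply: mseq_cons; last by apply: ih; exact: ltnW.
move=> _ Y mY; rewrite setTI; apply: sub_sigma_algebra.
exists (fun i => if i == k then Y else setT); first by move=> i; case: ifP.
apply/seteqP; split => [w /= Yw i _|w /(_ k kn)] /=.
  by case: eqP => // ->.
by rewrite eqxx.
Qed.

Lemma P_inter_rectangle n X B : rectangles n X -> measurable B ->
  P (X `&` xi n @^-1` B) = (P X * normal_prob 0 s B)%E.
Proof.
move=> [A mA ->] mB.
pose A' i := if i == n then B else A i.
have mA' i : measurable (A' i) by rewrite /A'; case: ifP.
have E : (\bigcap_(i in `I_n) [set w | A i (xi i w)]) `&` xi n @^-1` B =
    \bigcap_(i in `I_n.+1) [set w | A' i (xi i w)].
  apply/seteqP; split => [w [Aw Bw] i /= |w Aw].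
    rewrite ltnS leq_eqVlt /A' => /orP[/eqP ->|i_n]; first by rewrite eqxx.
    by rewrite (ltn_eqF i_n); exact: Aw.
  split; last by have /= := Aw n (ltnSn n); rewrite /A' eqxx.
  move=> i /= i_n; have /= := Aw i (ltnW i_n : (i < n.+1)%N).
  by rewrite /A' (ltn_eqF i_n).
rewrite E !indep// big_ord_recr/= EFinM; congr (_ * _)%E.
  by congr EFin; apply: eq_bigr => i _; rewrite /A' (ltn_eqF (ltn_ord i)).
by rewrite /A' eqxx fineK// fin_num_measure.
Qed.

(** For fixed B both sides are finite measures in X that agree on the pi-system of rectangles, hence
    on the sigma-algebra it generates. *)
Lemma P_inter_past n X B : <<s rectangles n >> X -> measurable B ->
  P (X `&` xi n @^-1` B) = (P X * normal_prob 0 s B)%E.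
Proof.
move=> sX mB; have mD : measurable (xi n @^-1` B).
  by rewrite -[X in measurable X]setTI; exact: mxi.
have nB : normal_prob 0 s B = (fine (normal_prob 0 s B))%:E.
  by rewrite fineK// fin_num_measure.
have nB0 : 0 <= fine (normal_prob 0 s B) by exact: fine_ge0.
rewrite nB muleC.
apply: (g_sigma_algebra_measure_unique (rectangles n) _ (fun=> setT) _ _
  (mrestr P mD) (mscale (NngNum nB0) P)) sX.
- exact: measurable_rectangle.
- by move=> _; exact: rectangles_setT.
- by rewrite bigcup_const.
- exact: setI_closed_rectangles.
- move=> A rA; apply: etrans (P_inter_rectangle n A B rA mB) _.
  by rewrite muleC {1}nB.
- move=> _; apply: le_lt_trans (probability_le1 P _) (ltry 1).
  exact: measurableI.
Qed.

(** By [P_inter_past] the pair (past, newest increment) has a product law; Tonelli then integrates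
    out the newest increment, and the induction handles the past. *)
Lemma integral_rev_increments n (F : seq R -> \bar R) :
  (forall v, 0 <= F v)%E -> seqmeas n F ->
  (\int[P]_w F (rev_increments n w) = iter_int (normal_pdf 0 s) n F)%E.
Proof.
elim: n F => [|n ih] F F0 mF.
  by rewrite /= integral_cst//= (@probability_setT _ _ _ P) mule1.
rewrite [RHS]/= -ih; last 2 first.
- by move=> v; apply: integral_ge0 => u _; rewrite mule_ge0// lee_fin normal_pdf_ge0.
- by apply: seqmeas_integral => // [|u]; [exact: measurable_normal_pdf|exact: normal_pdf_ge0].
have mid := measurable_past n.
pose g (w : Omega) : past n * measurableTypeR R := (w, xi n w).
have mg : measurable_fun setT g.
  apply: (@measurable_fun_pair _ _ _ Omega (past n) (measurableTypeR R)) => //.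
  exact: mxi.
pose idf : {mfun Omega >-> past n} :=
  HB.pack (id : Omega -> past n) (isMeasurableFun.Build _ _ _ _ _ mid).
pose gf : {mfun Omega >-> (past n * measurableTypeR R)%type} :=
  HB.pack g (isMeasurableFun.Build _ _ _ _ _ mg).
pose P' : probability (past n) R := distribution P idf.
pose Q : probability (past n * measurableTypeR R)%type R := distribution P gf.
have PQ : forall X, measurable X -> (P' \x normal_prob 0 s)%E X = Q X.
  apply: (@product_measure_unique _ _ _ _ _ P' (normal_prob 0 s) Q) => A B mA mB.
  exact: (P_inter_past n A B).
have mF' : measurable_fun setT (fun z : past n * measurableTypeR R => F (z.2 :: rev_increments n z.1)).
  apply: (mF _ _ (fun z : past n * measurableTypeR R => z.2 :: rev_increments n z.1)).
  apply: mseq_cons => //; apply: (mseq_comp _ _ _ _ _ fst (rev_increments n : past n -> _)) => //.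
  exact: mseq_rev_increments_past.
transitivity (\int[Q]_z F (z.2 :: rev_increments n z.1))%E.
  by rewrite (ge0_integral_pushforward mg).
transitivity (\int[(P' \x normal_prob 0 s)%E]_z F (z.2 :: rev_increments n z.1))%E.
  by apply: eq_measure_integral => A mA _; exact/esym/PQ.
rewrite fubini_tonelli1//.
rewrite (ge0_integral_pushforward mid)//=; last 2 first.
- exact: measurable_fun_fubini_tonelli_F.
- by move=> w _; apply: integral_ge0.
apply: eq_integral => w _; rewrite /fubini_F/=.
apply: ge0_integral_normal_prob => //.
by apply: seqmeas_cons mF _; exact: (mseq_rev_increments n).1.
Qed.

End LawOfIncrements.

(** * Comparison of cosh with its Taylor polynomial of degree 2 *)

Section CoshEstimates.
Context {R : realType}.
Implicit Types a x y u h : R.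

Definition sh x : R := (expR x - expR (- x)) / 2.

Lemma ch_double x : ch (2 * x) = 1 + 2 * sh x ^+ 2.
Proof.
rewrite /ch /sh (_ : 2 * x = x + x); last by lra.
rewrite opprD !expRD; have : expR x * expR (- x) = 1 by rewrite -expRD subrr expR0.
by move: (expR x) (expR (- x)) => X Y XY; lra.
Qed.

Lemma is_derive_sh x : is_derive x 1 sh (ch x).
Proof.
rewrite /sh /ch; apply: is_derive_eq.
by rewrite !scaler0 add0r mulrN1 opprK /GRing.scale/= mulrC.
Qed.

Lemma sh_le x : 0 <= x -> sh x <= x * expR x.
Proof.
move=> x0; have E : expR (- x) = expR x * expR (- (2 * x)).
  by rewrite -expRD; congr expR; lra.
have := expR_ge1Dx (- (2 * x)); rewrite /sh E; have := expR_gt0 x.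
by move: (expR x) (expR (- (2 * x))) => X Y; nra.
Qed.

(** By the mean value theorem sh a = a ch c for some c in [0, a], and ch c - 1 = 2 sh (c / 2)^2 lies
    between 0 and a^2 exp a / 2. *)
Lemma sh_sub_bounds a : 0 <= a -> a <= sh a /\ sh a - a <= a ^+ 3 * expR a / 2.
Proof.
move=> a0.
have sh0 : sh 0 = 0 by rewrite /sh oppr0 subrr mul0r.
have [|c] := @MVT_segment R sh ch 0 a a0 (fun x _ => is_derive_sh x).
  apply: derivable_within_continuous => x _.
  by case: (is_derive_sh x).
rewrite sh0 !subr0 in_itv/= => /andP[c0 ca] ->.
rewrite (_ : c = 2 * (c / 2)); last by lra.
rewrite ch_double; have c20 : 0 <= c / 2 by lra.
split; first by have := sqr_ge0 (sh (c / 2)); nra.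
have s0 : 0 <= sh (c / 2).
  rewrite /sh; have : expR (- (c / 2)) <= expR (c / 2) by rewrite ler_expR; lra.
  by lra.
have s1 := sh_le _ c20.
have s2 : sh (c / 2) ^+ 2 <= (a / 2) ^+ 2 * expR a.
  apply: (@le_trans _ _ ((c / 2 * expR (c / 2)) ^+ 2)).
    by rewrite ler_sqr// nnegrE mulr_ge0// expR_ge0.
  rewrite exprMn -expRM_natr; apply: ler_pM; rewrite ?sqr_ge0 ?expR_ge0//.
    by rewrite ler_sqr ?nnegrE; lra.
  by rewrite ler_expR; lra.
rewrite (_ : a ^+ 3 * expR a / 2 = (2 * ((a / 2) ^+ 2 * expR a)) * a); last by field.
rewrite -[X in _ - X]mul1r -mulrBl; apply: ler_wpM2r => //; lra.
Qed.

Lemma ch_norm u : ch `|u| = ch u.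
Proof. by have [_|_] := ger0P u; rewrite ?chN. Qed.

(** With x = |u| and s = sh (x / 2), the middle term factors as 2 (s - x / 2) (s + x / 2);
    [sh_sub_bounds] controls the first factor and [sh_le] the second. *)
Lemma ch_taylor_bounds u :
  0 <= ch u - 1 - u ^+ 2 / 2 <= `|u| ^+ 4 * expR `|u| / 8.
Proof.
rewrite -ch_norm -(real_normK (num_real u)).
have u0 := normr_ge0 u; move: `|u| u0 => x x0.
have a0 : 0 <= x / 2 by lra.
have [s1 s2] := sh_sub_bounds _ a0; have s3 := sh_le _ a0.
have -> : ch x = 1 + 2 * sh (x / 2) ^+ 2.
  by rewrite -ch_double; congr ch; lra.
have E0 := expR_gt0 (x / 2).
have E1 : 1 <= expR (x / 2) by rewrite -[leLHS]expR0 ler_expR.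
have -> : expR x = expR (x / 2) ^+ 2 by rewrite -expRM_natr; congr expR; lra.
move: (sh (x / 2)) (expR (x / 2)) s1 s2 s3 E0 E1 a0 => s e s1 s2 s3 e0 e1 a0.
have -> : 1 + 2 * s ^+ 2 - 1 - x ^+ 2 / 2 = 2 * ((s - x / 2) * (s + x / 2)) by field.
have -> : x ^+ 4 * e ^+ 2 / 8 = 2 * (((x / 2) ^+ 3 * e / 2) * (2 * (x / 2 * e))) by field.
apply/andP; split; first by rewrite mulr_ge0// mulr_ge0; lra.
rewrite ler_pM2l//; apply: ler_pM; [lra|lra|lra|].
have : x / 2 <= x / 2 * e by rewrite ler_peMr//.
lra.
Qed.

Definition defect h u : R := (ch u - 1 - u ^+ 2 / 2) / h.

Lemma defect_ge0 h u : 0 < h -> 0 <= defect h u.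
Proof.
by move=> h0; have /andP[? _] := ch_taylor_bounds u; rewrite /defect divr_ge0// ltW.
Qed.

(** The 8 comes from [ch_taylor_bounds]; exp 4 and 32^2 are the costs of bounding exp y and y^4 each
    by a multiple of exp (y^2 / 16). *)
Definition defect_cst : R := 32 ^+ 2 * expR 4 / 8.

(** In the scale y = |u| / sqrt h of a standard normal variable, u^4 / h is h y^4, the source of the
    factor h. The rate 1 / (8 h) is small enough for the square of the bound to remain integrable
    against N(0, h). *)
Lemma defect_le h u : 0 < h -> h <= 1 ->
  defect h u <= h * defect_cst * expR (u ^+ 2 / (8 * h)).
Proof.
move=> h0 h1; set r := Num.sqrt h.
have r0 : 0 < r by rewrite sqrtr_gt0.
have rr : h = r ^+ 2 by rewrite sqr_sqrtr// ltW.
have r1 : r <= 1 by rewrite -sqrtr1 ler_wsqrtr.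
pose y := `|u| / r.
have y0 : 0 <= y by rewrite divr_ge0// ltW.
have uy : `|u| = r * y by rewrite mulrC divfK// gt_eqF.
have -> : u ^+ 2 / (8 * h) = y ^+ 2 / 8.
  by rewrite -real_normK ?num_real// uy rr; field; rewrite gt_eqF.
have /andP[_ t2] := ch_taylor_bounds u.
rewrite /defect ler_pdivrMr//; apply: (le_trans t2); rewrite uy.
have e1 : expR (r * y) <= expR 4 * expR (y ^+ 2 / 16).
  rewrite -expRD ler_expR; have := sqr_ge0 (y / 4 - 2); have : r * y <= y by rewrite ler_piMl.
  by lra.
have e2 : y ^+ 4 <= 32 ^+ 2 * expR (y ^+ 2 / 16).
  have -> : expR (y ^+ 2 / 16) = expR (y ^+ 2 / 32) ^+ 2.
    by rewrite -expRM_natr; congr expR; lra.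
  rewrite -exprMn (exprM y 2 2) ler_sqr ?nnegrE ?sqr_ge0 ?mulr_ge0 ?expR_ge0//.
  by rewrite mulrC -ler_pdivrMr//; have := expR_ge1Dx (y ^+ 2 / 32); lra.
have -> : expR (y ^+ 2 / 8) = expR (y ^+ 2 / 16) * expR (y ^+ 2 / 16).
  by rewrite -expRD; congr expR; lra.
rewrite exprMn rr /defect_cst.
have r4 : 0 <= r ^+ 4 by rewrite exprn_ge0// ltW.
have -> : r ^+ 2 * (32 ^+ 2 * expR 4 / 8) * (expR (y ^+ 2 / 16) * expR (y ^+ 2 / 16)) * r ^+ 2
  = r ^+ 4 * ((32 ^+ 2 * expR (y ^+ 2 / 16)) * (expR 4 * expR (y ^+ 2 / 16))) / 8 by field.
rewrite ler_pM2r ?invr_gt0//.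
rewrite -[leLHS]mulrA ler_wpM2l//.
by apply: ler_pM => //; rewrite ?exprn_ge0 ?expR_ge0.
Qed.

Lemma measurable_defect h : measurable_fun setT (defect h).
Proof.
apply: measurable_funM => //; apply: measurable_funB; last exact: measurable_funM.
by apply: measurable_funB => //; exact: measurable_ch.
Qed.

Lemma walk_weight_normal h u : 0 < h ->
  expR (- defect h u) * normal_pdf 0 (Num.sqrt h) u =
  normal_peak (Num.sqrt h) * expR (h^-1) * walk_weight h u.
Proof.
move=> h0; rewrite normal_pdfE ?gt_eqF ?sqrtr_gt0// /normal_fun subr0.
rewrite sqr_sqrtr; last exact: ltW.
rewrite mulrCA -!mulrA; congr (_ * _); rewrite /walk_weight -!expRD; congr expR.
by rewrite /defect; field; rewrite gt_eqF.
Qed.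

End CoshEstimates.

(** * Integrals of bounded functions under a probability *)

Section BoundedIntegrals.
Context {R : realType} {d : measure_display} {T : measurableType d}.
Variable P : probability T R.
Implicit Types f g : T -> R.

Lemma bounded_integrable f (M : R) : measurable_fun setT f ->
  (forall x, `|f x| <= M) -> P.-integrable setT (EFin \o f).
Proof.
move=> mf fM; apply: le_integrable (finite_measure_integrable_cst P M measurableT) => //.
  exact/measurable_EFinP.
by move=> x _ /=; rewrite lee_fin (le_trans (fM x))// ler_norm.
Qed.

Lemma Rintegral_prob_cst (c : R) : (\int[P]_x c)%R = c.
Proof.
by rewrite Rintegral_cst//= (@probability_setT _ _ _ P) mulr1.
Qed.

Lemma EFin_Rintegral f (M : R) : measurable_fun setT f -> (forall x, `|f x| <= M) ->
  ((\int[P]_x f x)%R)%:E = (\int[P]_x (f x)%:E)%E.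
Proof.
move=> mf fM; rewrite /Rintegral fineK//.
by apply: integrable_fin_num => //; exact: bounded_integrable mf fM.
Qed.

Lemma Rintegral_le_cst f (M c : R) : measurable_fun setT f -> (forall x, `|f x| <= M) ->
  (\int[P]_x (f x)%:E <= c%:E)%E -> (\int[P]_x f x)%R <= c.
Proof. by move=> mf fM fc; rewrite -lee_fin (EFin_Rintegral _ M). Qed.

End BoundedIntegrals.

(** * Mean and variance of one likelihood factor *)

Section OneStep.
Context {R : realType} (h : R).
Hypotheses (h0 : 0 < h) (h1 : h <= 1).
Notation mu := (@lebesgue_measure R).
Notation nu := (normal_prob 0 (Num.sqrt h)).
Notation C := (@defect_cst R).

Definition likelihood (u : R) : R := expR (- defect h u).

Definition mean_likelihood : R := (\int[nu]_u likelihood u)%R.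
Definition mean_sqr_likelihood : R := (\int[nu]_u (likelihood u ^+ 2))%R.

Lemma measurable_likelihood : measurable_fun setT likelihood.
Proof.
by apply: measurable_fun_expR; apply: measurableT_comp => //; exact: measurable_defect.
Qed.

Lemma likelihood_ge0 u : 0 <= likelihood u. Proof. exact: expR_ge0. Qed.

Lemma likelihood_le1 u : likelihood u <= 1.
Proof. by rewrite -[leRHS]expR0 ler_expR oppr_le0 defect_ge0. Qed.

Lemma normal_peak_double :
  normal_peak (Num.sqrt h) <= 2 * normal_peak (Num.sqrt (2 * h)).
Proof.
have h2 : 0 <= 2 * h by rewrite mulr_ge0// ltW.
have -> : normal_peak (Num.sqrt (2 * h)) = (Num.sqrt (2 * (h * pi *+ 2)))^-1.
  by rewrite /normal_peak (sqr_sqrtr h2) -mulrA -mulrnAr.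
have -> : normal_peak (Num.sqrt h) = (Num.sqrt (h * pi *+ 2))^-1.
  by rewrite /normal_peak (sqr_sqrtr (ltW h0)).
have X0 : 0 < h * pi *+ 2 by rewrite mulrn_wgt0// mulr_gt0// pi_gt0.
move: (h * pi *+ 2) X0 => X X0.
rewrite sqrtrM// invfM mulrA ler_peMl ?invr_ge0 ?sqrtr_ge0//.
rewrite ler_pdivlMr ?sqrtr_gt0// mul1r.
have := @sqr_sqrtr R 2 ltac:(lra); have := sqrtr_ge0 (2 : R).
by move: (Num.sqrt 2) => r; nra.
Qed.

(** The exponential turns the shape of N(0, h) into that of N(0, 2 h), of total mass 1; the ratio of
    the two peaks is sqrt 2, bounded here by 2. *)
Lemma integral_expR_sqr_le :
  (\int[nu]_u (expR (u ^+ 2 / (4 * h)))%:E <= 2%:E)%E.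
Proof.
have m4 : measurable_fun setT (fun u : R => (expR (u ^+ 2 / (4 * h)))%:E).
  apply/measurable_EFinP; apply: measurable_fun_expR; exact: measurable_funM.
rewrite ge0_integral_normal_prob//.
rewrite [leRHS](_ : _ = 2%:E * \int[mu]_u (normal_pdf 0 (Num.sqrt (2 * h)) u)%:E)%E;
  last by rewrite integral_normal_pdf mule1.
have mp := measurable_normal_pdf 0 (Num.sqrt (2 * h)).
rewrite -ge0_integralZl//; last 2 first.
- exact/measurable_EFinP.
- by move=> u _; rewrite lee_fin normal_pdf_ge0.
apply: ge0_le_integral => //.
- by move=> u _; rewrite mule_ge0// lee_fin ?expR_ge0 ?normal_pdf_ge0.
- apply: emeasurable_funM; first exact: m4.
  apply/measurable_EFinP; exact: measurable_normal_pdf.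
- apply: emeasurable_funM; first exact: measurable_cst.
  exact/measurable_EFinP.
- move=> u _; rewrite -!EFinM lee_fin !normal_pdfE ?gt_eqF ?sqrtr_gt0 ?mulr_gt0//.
  have h2 : 0 <= 2 * h by rewrite mulr_ge0// ltW.
  rewrite mulrCA /normal_fun !subr0 (sqr_sqrtr h2) (sqr_sqrtr (ltW h0)).
  rewrite -expRD (_ : u ^+ 2 / (4 * h) + - u ^+ 2 / (h *+ 2) = - u ^+ 2 / ((2 * h) *+ 2)).
    by rewrite mulrA ler_wpM2r ?expR_ge0// normal_peak_double.
  by field; rewrite gt_eqF.
Qed.

Lemma one_sub_likelihood u :
  0 <= 1 - likelihood u <= h * C * expR (u ^+ 2 / (8 * h)).
Proof.
rewrite subr_ge0 likelihood_le1/=; apply: le_trans (defect_le h u h0 h1).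
by rewrite lerBlDr addrC -lerBlDr; exact: expR_ge1Dx.
Qed.

Lemma defect_cst_ge0 : 0 <= C. Proof. by rewrite mulr_ge0// expR_ge0. Qed.

Lemma integral_le_scaled_expR (f : R -> R) (c : R) : 0 <= c ->
  measurable_fun setT f -> (forall u, 0 <= f u <= 1) ->
  (forall u, f u <= c * expR (u ^+ 2 / (4 * h))) ->
  (\int[nu]_u f u)%R <= c * 2.
Proof.
move=> c0 mf f01 fc.
have m4 : measurable_fun setT (fun u : R => (expR (u ^+ 2 / (4 * h)))%:E).
  apply/measurable_EFinP; apply: measurable_fun_expR; exact: measurable_funM.
apply: (@Rintegral_le_cst _ _ _ nu _ 1) => //.
  by move=> u; have /andP[f0 f1] := f01 u; rewrite ger0_norm.
apply: (@le_trans _ _ (\int[nu]_u (c%:E * (expR (u ^+ 2 / (4 * h)))%:E))%E).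
  apply: ge0_le_integral => //.
  - by move=> u _; rewrite lee_fin; have /andP[] := f01 u.
  - exact/measurable_EFinP.
  - by apply: emeasurable_funM; [exact: measurable_cst|exact: m4].
  - by move=> u _; rewrite -EFinM lee_fin.
rewrite ge0_integralZl//.
rewrite EFinM; apply: lee_wpmul2l; first by rewrite lee_fin.
exact: integral_expR_sqr_le.
Qed.

(** Serves to keep the normalization away from 0: for small h the mean is at least 1 / 2. *)
Lemma one_sub_mean_likelihood : 1 - mean_likelihood <= h * C * 2.
Proof.
have mk := measurable_likelihood.
have ik : nu.-integrable setT (EFin \o likelihood).
  apply: (@bounded_integrable _ _ _ nu _ 1) => // u.
  by rewrite ger0_norm ?likelihood_ge0 ?likelihood_le1.
rewrite -[X in X - _](Rintegral_prob_cst nu) -RintegralB//; last first.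
  exact: finite_measure_integrable_cst.
apply: integral_le_scaled_expR.
- by rewrite mulr_ge0 ?defect_cst_ge0// ltW.
- exact: measurable_funB.
- by move=> u; have := likelihood_ge0 u; have := likelihood_le1 u; lra.
- move=> u; have /andP[_ +] := one_sub_likelihood u => /le_trans; apply.
  rewrite ler_wpM2l ?mulr_ge0 ?defect_cst_ge0 ?(ltW h0)// ler_expR.
  by rewrite ler_wpM2l ?sqr_ge0// lef_pV2 ?posrE ?mulr_gt0// ler_pM2r// ler_nat.
Qed.

(** The variance is that of 1 - k, hence at most the second moment of 1 - k, and 1 - k is pointwise
    of order h. The order h^2 is essential, since t / h such variances accumulate. *)
Lemma var_likelihood :
  mean_sqr_likelihood - mean_likelihood ^+ 2 <= (h * C) ^+ 2 * 2.
Proof.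
have mk := measurable_likelihood.
have ik : nu.-integrable setT (EFin \o likelihood).
  apply: (@bounded_integrable _ _ _ nu _ 1) => // u.
  by rewrite ger0_norm ?likelihood_ge0 ?likelihood_le1.
have ik2 : nu.-integrable setT (EFin \o (fun u => likelihood u ^+ 2)).
  apply: (@bounded_integrable _ _ _ nu _ 1) => [|u]; first exact: measurable_funX.
  by rewrite ger0_norm ?sqr_ge0//; apply: exprn_ile1; rewrite ?likelihood_ge0 ?likelihood_le1.
have i1 : nu.-integrable setT (EFin \o (cst 1 : R -> R)).
  exact: finite_measure_integrable_cst.
have i2k : nu.-integrable setT (EFin \o (fun u => 2 * likelihood u)).
  apply: (@bounded_integrable _ _ _ nu _ 2) => [|u]; first exact: measurable_funM.
  rewrite ger0_norm ?mulr_ge0 ?likelihood_ge0//.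
  by have := likelihood_le1 u; lra.
have E : (\int[nu]_u ((1 - likelihood u) ^+ 2))%R =
    1 - 2 * mean_likelihood + mean_sqr_likelihood.
  transitivity (\int[nu]_u ((1 - 2 * likelihood u) + likelihood u ^+ 2))%R.
    by apply: eq_Rintegral => u _; ring.
  rewrite RintegralD//; last first.
    by apply: (integrableB measurableT i1 i2k).
  by rewrite RintegralB// RintegralZl// Rintegral_prob_cst.
have := sqr_ge0 (1 - mean_likelihood).
suff : (\int[nu]_u ((1 - likelihood u) ^+ 2))%R <= (h * C) ^+ 2 * 2 by rewrite E; lra.
apply: integral_le_scaled_expR.
- exact: sqr_ge0.
- by apply: measurable_funX; exact: measurable_funB.
- move=> u; rewrite sqr_ge0 expr_le1//=.
    by have := likelihood_ge0 u; lra.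
  by have := likelihood_le1 u; lra.
- move=> u; have /andP[p0 p1] := one_sub_likelihood u.
  have -> : expR (u ^+ 2 / (4 * h)) = expR (u ^+ 2 / (8 * h)) ^+ 2.
    by rewrite -expRM_natr; congr expR; field; rewrite gt_eqF.
  rewrite -exprMn ler_sqr// nnegrE.
  exact: le_trans p1.
Qed.

End OneStep.

(** * Almost invariance of Gaussian walks under the reflection *)

Section AlmostInvariance.
Context {R : realType} {d : measure_display} {Omega : measurableType d}.
Variables (P : probability Omega R) (xi : nat -> Omega -> R) (h : R).
Hypotheses (h0 : 0 < h) (h1 : h <= 1).
Hypothesis mxi : forall i, measurable_fun setT (xi i).
Hypothesis indep : forall (n : nat) (A : nat -> set R),
  (forall i, measurable (A i)) ->
  P (\bigcap_(i in `I_n) [set w | A i (xi i w)]) =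
  (\prod_(i < n) fine (normal_prob 0 (Num.sqrt h) (A i)))%:E.
Notation V := (rev_increments xi).
Notation k := (likelihood h).
Notation phi := (normal_pdf 0 (Num.sqrt h)).
Notation q := (mean_likelihood h).
Notation q2 := (mean_sqr_likelihood h).
Notation C := (@defect_cst R).

Definition path_likelihood (v : seq R) : R := \prod_(u <- v) k u.

Lemma path_likelihood_bounds v : 0 <= path_likelihood v <= 1.
Proof.
rewrite /path_likelihood; elim: v => [|u v /andP[p0 p1]].
  by rewrite big_nil ler01 lexx.
rewrite big_cons; have l0 := likelihood_ge0 h u; have l1 := likelihood_le1 h h0 u.
by rewrite mulr_ge0//= mulr_ile1.
Qed.

Lemma seqmeas_path_likelihood n : seqmeas n path_likelihood.
Proof.
elim: n => [|n ih] dT T s ms.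
  rewrite /comp; under eq_fun => w do rewrite (size0nil (ms.1 w)).
  exact: measurable_cst.
rewrite (mseq_head_behead _ _ _ _ ms) /comp /path_likelihood.
under eq_fun do rewrite big_cons.
apply: measurable_funM.
  by apply: (measurableT_comp (measurable_likelihood h)); exact: mseq_head ms.
by apply: (ih _ _ (fun w => behead (s w))); exact: mseq_behead.
Qed.

Let c : R := normal_peak (Num.sqrt h) * expR h^-1.

Let c_ge0 : 0 <= c. Proof. by rewrite mulr_ge0 ?normal_peak_ge0 ?expR_ge0. Qed.

Lemma integral_path_likelihood n (F : seq R -> \bar R) :
  (forall v, 0 <= F v)%E -> seqmeas n F ->
  (\int[P]_w (F (V n w) * (path_likelihood (V n w))%:E) =
   iter_int (fun u => k u * phi u)%R n F)%E.
Proof.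
move=> F0 mF.
rewrite (integral_rev_increments P xi (Num.sqrt h) mxi indep n
  (fun v => F v * (path_likelihood v)%:E)%E).
- apply: iter_int_density => //.
  + exact: measurable_normal_pdf.
  + exact: normal_pdf_ge0.
  + exact: measurable_likelihood.
  + exact: likelihood_ge0.
- by move=> v; rewrite mule_ge0// lee_fin; have /andP[] := path_likelihood_bounds v.
- move=> dT T s ms; apply: emeasurable_funM; first exact: (mF _ _ s).
  by apply/measurable_EFinP; exact: (seqmeas_path_likelihood n _ _ s).
Qed.

Lemma integral_path_likelihood_walk n (F : seq R -> \bar R) :
  (forall v, 0 <= F v)%E -> seqmeas n F ->
  (\int[P]_w (F (V n w) * (path_likelihood (V n w))%:E) =
   (c ^+ n)%:E * iter_int (walk_weight h) n F)%E.
Proof.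
move=> F0 mF; rewrite integral_path_likelihood//.
have -> : (fun u => k u * phi u) = (fun u => c * walk_weight h u).
  by apply/funext => u; exact: walk_weight_normal.
have mw := measurable_walk_weight h.
have w0 u : 0 <= walk_weight h u by exact: expR_ge0.
rewrite -(iter_int_density (walk_weight h) (cst c))//.
rewrite -iter_intZl ?exprn_ge0//.
apply: eq_iter_int => v sv.
by rewrite muleC; congr (_%:E * _)%E; rewrite big_const_seq count_predT sv iter_mulr_1.
Qed.

(** Both sides are c^(n+1) times an integral over the cosh walk, so this constant never has to be
    evaluated. *)
Lemma integral_reflect_path_likelihood n (F : seq R -> \bar R) :
  (forall v, 0 <= F v)%E -> seqmeas n.+1 F ->
  (\int[P]_w (F (reflect h (V n.+1 w)) * (path_likelihood (V n.+1 w))%:E) =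
   \int[P]_w (F (V n.+1 w) * (path_likelihood (V n.+1 w))%:E))%E.
Proof.
move=> F0 mF.
have mFr : seqmeas n.+1 (F \o reflect h).
  by move=> dT T s ms; apply: (mF _ _ (reflect h \o s)); exact: mseq_reflect.
rewrite (integral_path_likelihood_walk n.+1 (F \o reflect h))//; last by move=> v; exact: F0.
by rewrite iter_int_reflect// integral_path_likelihood_walk.
Qed.

Lemma iter_int_cst1 (g : R -> R) (m : R) n : measurable_fun setT g ->
  (forall u, 0 <= g u) -> (\int[lebesgue_measure]_u (g u)%:E = m%:E)%E ->
  iter_int g n (cst 1%E) = (m ^+ n)%:E.
Proof.
move=> mg g0 gm; elim: n => [//|n ih] /=.
have m0 : 0 <= m by rewrite -lee_fin -gm; apply: integral_ge0 => u _; rewrite lee_fin.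
transitivity (iter_int g n (fun v => m%:E * cst 1 v)%E).
  apply: eq_iter_int => v _; rewrite mule1 -gm; apply: eq_integral => u _.
  by rewrite mul1e.
rewrite (iter_intZl g n (cst 1%E))//.
  by rewrite ih exprS.
by move=> dT T s ms; exact: measurable_cst.
Qed.

Lemma likelihoodX_integral (j : nat) :
  (\int[lebesgue_measure]_u (k u ^+ j * phi u)%:E)%E =
  ((\int[normal_prob 0 (Num.sqrt h)]_u (k u ^+ j))%R)%:E.
Proof.
have mk : measurable_fun setT (fun u => k u ^+ j).
  by apply: measurable_funX; exact: measurable_likelihood.
rewrite (@EFin_Rintegral _ _ _ (normal_prob 0 (Num.sqrt h)) _ 1)//.
  rewrite ge0_integral_normal_prob//; first exact/measurable_EFinP.
  by move=> u; rewrite lee_fin exprn_ge0// likelihood_ge0.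
move=> u; rewrite ger0_norm ?exprn_ge0 ?likelihood_ge0//.
by apply: exprn_ile1; rewrite ?likelihood_ge0 ?likelihood_le1.
Qed.

Lemma measurable_path_likelihood_V n :
  measurable_fun setT (fun w => path_likelihood (V n w)).
Proof. by apply: (seqmeas_path_likelihood n _ _ (V n)); exact: mseq_rev_increments. Qed.

Lemma expectation_path_likelihood n :
  (\int[P]_w path_likelihood (V n w))%R = q ^+ n.
Proof.
have mk := measurable_likelihood h; have mp := measurable_normal_pdf 0 (Num.sqrt h).
apply: EFin_inj; rewrite (@EFin_Rintegral _ _ _ P _ 1); last 2 first.
- exact: measurable_path_likelihood_V.
- by move=> w; have /andP[p0 p1] := path_likelihood_bounds (V n w); rewrite ger0_norm.
under eq_integral => w _ do rewrite -[X in X%:E]mul1r EFinM.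
rewrite (integral_path_likelihood n (cst 1%E))//; last first.
  by move=> dT T s ms; exact: measurable_cst.
apply: iter_int_cst1.
- exact: measurable_funM.
- by move=> u; rewrite mulr_ge0 ?likelihood_ge0 ?normal_pdf_ge0.
- by have := likelihoodX_integral 1; rewrite /mean_likelihood.
Qed.

Lemma expectation_sqr_path_likelihood n :
  (\int[P]_w (path_likelihood (V n w) ^+ 2))%R = q2 ^+ n.
Proof.
have mk := measurable_likelihood h; have mp := measurable_normal_pdf 0 (Num.sqrt h).
have mk2 : measurable_fun setT (fun u => k u ^+ 2) by exact: measurable_funX.
apply: EFin_inj; rewrite (@EFin_Rintegral _ _ _ P _ 1); last 2 first.
- by apply: measurable_funX; exact: measurable_path_likelihood_V.
- move=> w; have /andP[p0 p1] := path_likelihood_bounds (V n w).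
  by rewrite ger0_norm ?sqr_ge0//; exact: exprn_ile1.
have E v : ((path_likelihood v ^+ 2)%:E = 1 * (\prod_(u <- v) (k u ^+ 2))%:E :> \bar R)%E.
  by rewrite mul1e /path_likelihood prodrXl.
under eq_integral => w _ do rewrite E.
rewrite (integral_rev_increments P xi (Num.sqrt h) mxi indep n
  (fun v => 1 * (\prod_(u <- v) (k u ^+ 2))%:E)%E).
- rewrite (iter_int_density phi (fun u => k u ^+ 2) n (cst 1%E))//.
  + apply: iter_int_cst1.
    * exact: measurable_funM.
    * by move=> u; rewrite mulr_ge0 ?sqr_ge0 ?normal_pdf_ge0.
    * exact: likelihoodX_integral.
  + exact: normal_pdf_ge0.
  + by move=> u; exact: sqr_ge0.
  + by move=> dT T s ms; exact: measurable_cst.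
- by move=> v; rewrite -E lee_fin sqr_ge0.
- move=> dT T s ms; rewrite /comp; under eq_fun do rewrite -E.
  apply/measurable_EFinP; apply: measurable_funX.
  exact: (seqmeas_path_likelihood n _ _ s).
Qed.

(** One factor of the ratio is 1 + (q2 - q^2) / q^2, at most 1 + 8 (h C)^2 because the variance is
    at most 2 (h C)^2 and q^2 >= 1 / 4; then 1 + x <= exp x. *)
Lemma mean_sqr_likelihood_pow n : 2^-1 <= q ->
  q2 ^+ n / q ^+ n ^+ 2 <= expR (n%:R * (8 * (h * C) ^+ 2)).
Proof.
move=> q12; have q0 : 0 < q by apply: lt_le_trans q12; rewrite invr_gt0.
rewrite exprAC -expr_div_n expRM_natl; apply: lerXn2r.
- by rewrite nnegrE divr_ge0 ?sqr_ge0// /mean_sqr_likelihood; apply: Rintegral_ge0 => u _; exact: sqr_ge0.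
- by rewrite nnegrE expR_ge0.
apply: le_trans (expR_ge1Dx _).
rewrite ler_pdivrMr ?exprn_gt0// mulrDl mul1r.
have := var_likelihood h h0 h1; have : 2^-1 ^+ 2 <= q ^+ 2.
  by apply: lerXn2r => //; rewrite nnegrE ?invr_ge0// ltW.
have := sqr_ge0 (h * C); move: ((h * C) ^+ 2) (q ^+ 2) => X Y X0 Y4 XY.
have : 2 * X <= 8 * X * Y by nra.
lra.
Qed.

(** Let U be the likelihood and Q its mean. Exact invariance makes f o reflect - f orthogonal to U,
    so Q times the difference of expectations equals E[(f o reflect - f) (Q - U)], at most E|Q - U|.
    The relative variance of U controls this, and e balances the two terms of the bound. *)
Lemma reflect_expectation_close n (f : seq R -> R) (e : R) :
  seqmeas n.+1 f -> (forall v, 0 <= f v <= 1) -> 0 < e -> 2^-1 <= q ->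
  `|(\int[P]_w f (reflect h (V n.+1 w)))%R - (\int[P]_w f (V n.+1 w))%R| <=
  e + (expR (n.+1%:R * (8 * (h * C) ^+ 2)) - 1) / e.
Proof.
move=> mf f01 e0 q12; have q0 : 0 < q by apply: lt_le_trans q12; rewrite invr_gt0.
set Q := q ^+ n.+1; have Q0 : 0 < Q by rewrite exprn_gt0.
pose U w := path_likelihood (V n.+1 w).
have mU : measurable_fun setT U := measurable_path_likelihood_V n.+1.
have U01 w : 0 <= U w <= 1 by exact: path_likelihood_bounds.
have mV := mseq_rev_increments xi mxi n.+1.
pose f1 w := f (reflect h (V n.+1 w)); pose f2 w := f (V n.+1 w).
have mf2 : measurable_fun setT f2 by exact: (mf _ _ (V n.+1)).
have mf1 : measurable_fun setT f1.
  by apply: (mf _ _ (fun w => reflect h (V n.+1 w))); exact: mseq_reflect.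
have f101 w : 0 <= f1 w <= 1 by exact: f01.
have f201 w : 0 <= f2 w <= 1 by exact: f01.
have bi (g : Omega -> R) (M : R) := @bounded_integrable _ _ _ P g M.
have prod01 (x y : R) : 0 <= x <= 1 -> 0 <= y <= 1 -> `|x * y| <= 1.
  move=> /andP[x0 x1] /andP[y0 y1]; rewrite ger0_norm ?mulr_ge0//; nra.
have norm01 (x : R) : 0 <= x <= 1 -> `|x| <= 1.
  by move=> /andP[x0 x1]; rewrite ger0_norm.
have EfU : (\int[P]_w (f1 w * U w))%R = (\int[P]_w (f2 w * U w))%R.
  apply: EFin_inj; rewrite !(@EFin_Rintegral _ _ _ P _ 1); last 4 first.
  - exact: measurable_funM.
  - by move=> w; exact: prod01.
  - exact: measurable_funM.
  - by move=> w; exact: prod01.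
  under eq_integral do rewrite EFinM; under [RHS]eq_integral do rewrite EFinM.
  apply: (integral_reflect_path_likelihood n (EFin \o f)) => [v|dT T s ms].
    by rewrite lee_fin; have /andP[] := f01 v.
  by apply/measurable_EFinP; exact: (mf _ _ s).
have ifU1 := bi _ 1 (measurable_funM mf1 mU) (fun w => prod01 _ _ (f101 w) (U01 w)).
have ifU2 := bi _ 1 (measurable_funM mf2 mU) (fun w => prod01 _ _ (f201 w) (U01 w)).
have if1 := bi _ 1 mf1 (fun w => norm01 _ (f101 w)).
have if2 := bi _ 1 mf2 (fun w => norm01 _ (f201 w)).
have iU := bi _ 1 mU (fun w => norm01 _ (U01 w)).
have iUU := bi _ 1 (measurable_funM mU mU) (fun w => prod01 _ _ (U01 w) (U01 w)).
set D := _ - _; have DE : D = (\int[P]_w (f1 w - f2 w))%R by rewrite RintegralB.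
pose G w := (f1 w - f2 w) * (Q - U w).
have g1 w : `|f1 w - f2 w| <= 1.
  by have := f101 w; have := f201 w; move=> /andP[? ?] /andP[? ?]; rewrite ler_norml; apply/andP; split; lra.
have mg : measurable_fun setT (fun w => f1 w - f2 w) by exact: measurable_funB.
have mQU : measurable_fun setT (fun w => Q - U w) by exact: measurable_funB.
have mG : measurable_fun setT G by exact: measurable_funM.
have GQ w : `|G w| <= Q + 1.
  rewrite normrM -[leRHS]mul1r; apply: ler_pM => //; have /andP[? ?] := U01 w.
  by rewrite ler_norml; apply/andP; split; lra.
have iG := bi _ _ mG GQ.
have EG : (\int[P]_w G w)%R = Q * D.
  transitivity (\int[P]_w (Q * (f1 w - f2 w) - (f1 w * U w - f2 w * U w)))%R.
    by apply: eq_Rintegral => w _; rewrite /G; ring.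
  have ig := integrableB measurableT if1 if2.
  have igU := integrableB measurableT ifU1 ifU2.
  have iQg := integrableZl measurableT Q ig.
  rewrite RintegralB// RintegralZl// -DE.
  by rewrite RintegralB// EfU subrr subr0.
(* [b0], [b1] and [c2] are the coefficients of e Q / 2 + (Q - U)^2 / (2 e Q) as a polynomial in U,
   whose expectation only involves the first two moments. *)
pose c2 := (2 * e * Q)^-1.
have c20 : 0 < c2 by rewrite invr_gt0 !mulr_gt0.
pose b0 := e * Q / 2 + Q ^+ 2 * c2.
pose b1 := - (2 * Q * c2).
have EH : (\int[P]_w (b0 + (b1 * U w + c2 * (U w * U w))))%R =
    b0 + b1 * Q + c2 * q2 ^+ n.+1.
  have ib1 := integrableZl measurableT b1 iU.
  have ib2 := integrableZl measurableT c2 iUU.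
  have i0 := finite_measure_integrable_cst P b0 measurableT.
  have i12 := integrableD measurableT ib1 ib2.
  rewrite (RintegralD measurableT i0 i12) (RintegralD measurableT ib1 ib2).
  rewrite Rintegral_prob_cst !RintegralZl// -[RHS]addrA; congr (_ + (_ * _ + _ * _)).
    exact: expectation_path_likelihood.
  by rewrite -expectation_sqr_path_likelihood; apply: eq_Rintegral => w _; rewrite expr2.
(* |x| <= e Q / 2 + x^2 / (2 e Q), which avoids the Cauchy-Schwarz inequality. *)
have GH w : `|G w| <= b0 + (b1 * U w + c2 * (U w * U w)).
  have -> : b0 + (b1 * U w + c2 * (U w * U w)) = (e * Q) / 2 + (Q - U w) ^+ 2 * c2.
    by rewrite /b0 /b1; ring.
  rewrite normrM; apply: le_trans (_ : `|Q - U w| <= _).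
    by rewrite ler_piMl.
  rewrite -[X in _ + X * _]real_normK ?num_real//; move: `|Q - U w| => x.
  rewrite -subr_ge0 (_ : _ - x = c2 * (x - e * Q) ^+ 2); first by rewrite mulr_ge0 ?sqr_ge0// ltW.
  by rewrite /c2; field; rewrite !gt_eqF.
have iH : P.-integrable setT (EFin \o (fun w => b0 + (b1 * U w + c2 * (U w * U w)))).
  apply: (bi _ (`|b0| + (`|b1| + `|c2|))).
    apply: measurable_funD => //; apply: measurable_funD; apply: measurable_funM => //.
    exact: measurable_funM.
  move=> w; apply: le_trans (ler_normD _ _) _; rewrite lerD2l.
  apply: le_trans (ler_normD _ _) _; rewrite !normrM.
  by rewrite lerD// ler_piMr// ?mulr_ile1// norm01.
have iaG : P.-integrable setT (EFin \o (fun w => `|G w|)).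
  apply: (bi _ (Q + 1)); first exact: measurableT_comp.
  by move=> w; rewrite normr_id.
have le1 : Q * `|D| <= b0 + b1 * Q + c2 * q2 ^+ n.+1.
  rewrite -[X in X * _]gtr0_norm// -normrM -EG -EH.
  apply: le_trans (le_normr_Rintegral measurableT iG) _.
  by apply: le_Rintegral => // w _; exact: GH.
have le2 := mean_sqr_likelihood_pow n.+1 q12; rewrite -/Q in le2.
move: le1 le2; set X := q2 ^+ _; set Y := expR _ => le1 le2.
have le3 : `|D| <= (e + (X / Q ^+ 2 - 1) / e) / 2.
  rewrite -(ler_pM2l Q0); apply: le_trans le1 _.
  suff -> : Q * ((e + (X / Q ^+ 2 - 1) / e) / 2) = b0 + b1 * Q + c2 * X by [].
  by rewrite /b0 /b1 /c2; field; rewrite !gt_eqF.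
have Y1 : 1 <= Y.
  by rewrite -[leLHS]expR0 ler_expR mulr_ge0// mulr_ge0// sqr_ge0.
apply: le_trans le3 _.
have : (X / Q ^+ 2 - 1) / e <= (Y - 1) / e by rewrite ler_pM2r ?invr_gt0// lerB.
have : 0 <= (Y - 1) / e by rewrite divr_ge0 ?subr_ge0// ltW.
move: ((Y - 1) / e) ((X / Q ^+ 2 - 1) / e) => y x; lra.
Qed.

End AlmostInvariance.

(** * Pathwise convergence of the discrete map along a continuous path *)

Section MeshPaths.
Context {R : realType}.
Implicit Types (phi : R -> R) (h : R).

Fixpoint mesh_increments phi h (k : nat) : seq R :=
  if k is j.+1 then
    (phi (j.+1%:R * h) - phi (j%:R * h)) :: mesh_increments phi h j
  else [::].

(** As the latest increment comes first, the walk stopped at an earlier mesh point is a tail of the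
    list. *)
Lemma drop_mesh phi h j k : (j <= k)%N ->
  drop (k - j) (mesh_increments phi h k) = mesh_increments phi h j.
Proof.
elim: k => [|k ih]; first by rewrite leqn0 => /eqP ->.
rewrite leq_eqVlt ltnS => /predU1P[->|jk]; first by rewrite subnn drop0.
by rewrite subSn//= ih.
Qed.

Lemma pos_mesh phi h k : pos (mesh_increments phi h k) = phi (k%:R * h) - phi 0.
Proof.
elim: k => [|k ih]; first by rewrite /pos big_nil mul0r subrr.
by rewrite [mesh_increments _ _ _]/= pos_cons ih addrA subrK.
Qed.

Variables (phi : R -> R) (t : R).
Hypotheses (cphi : continuous phi) (phi0 : phi 0 = 0) (t0 : 0 < t).
Notation A := (Apath phi).
Let f (u : R) : R := expR (2 * phi u).

Lemma continuous_expR_path : continuous f.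
Proof.
move=> x; apply: (@continuous_comp _ _ _ (fun u => 2 * phi u) expR).
  by apply: cvgM; [exact: cvg_cst|exact: cphi].
exact: continuous_expR.
Qed.

Lemma integrable_expR_path (a b : R) :
  (@lebesgue_measure R).-integrable `[a, b] (EFin \o f).
Proof.
apply: continuous_compact_integrable; first exact: segment_compact.
exact/continuous_subspaceT/continuous_expR_path.
Qed.

Lemma Apath_increment_bounds (a b m M : R) : 0 <= a -> a <= b ->
  (forall x, a <= x <= b -> m <= f x <= M) ->
  (b - a) * m <= A b - A a <= (b - a) * M.
Proof.
move=> a0 ab mM.
have iab : (@lebesgue_measure R).-integrable `]a, b] (EFin \o f).
  apply: integrableS (integrable_expR_path a b) => //.
  by apply: subset_itvr; rewrite bnd_simp.
have mu_ab (c : R) : (\int[lebesgue_measure]_(x in `]a, b]) c)%R = (b - a) * c.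
  rewrite Rintegral_cst//= lebesgue_measure_itv/= lte_fin mulrC.
  by case: ltgtP ab => // -> _; rewrite subrr !mul0r.
have ic (c : R) : (@lebesgue_measure R).-integrable `]a, b] (EFin \o cst c).
  apply: integrableS (_ : (@lebesgue_measure R).-integrable `[a, b] (EFin \o cst c)) => //.
    by apply: subset_itvr; rewrite bnd_simp.
  apply: continuous_compact_integrable; first exact: segment_compact.
  by apply: continuous_subspaceT => x; exact: cvg_cst.
have -> : A b - A a = (\int[lebesgue_measure]_(x in `]a, b]) f x)%R.
  by rewrite /Apath Rintegral_itvB ?bnd_simp//; exact: integrable_expR_path.
have fmM x : x \in `]a, b] -> m <= f x <= M.
  by rewrite in_itv/= => /andP[ax xb]; apply: mM; rewrite (ltW ax).
rewrite -!mu_ab; apply/andP; split.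
- by apply: le_Rintegral => //; [exact: ic|move=> x /= /fmM /andP[]].
- by apply: le_Rintegral => //; [exact: ic|move=> x /= /fmM /andP[]].
Qed.

Lemma Apath0 : A 0 = 0.
Proof. by rewrite /Apath set_itv1 Rintegral_set1. Qed.

Lemma Apath_le (a b : R) : 0 <= a -> a <= b -> A a <= A b.
Proof.
move=> a0 ab; rewrite -subr_ge0.
have [c _ cM] := EVT_max ab (continuous_subspaceT continuous_expR_path).
have fM x : a <= x <= b -> 0 <= f x <= f c.
  by move=> xab; rewrite expR_ge0/= cM// in_itv.
by have /andP[+ _] := Apath_increment_bounds a b 0 (f c) a0 ab fM; rewrite mulr0.
Qed.

Lemma Apath_lipschitz : exists2 M : R, 0 < M &
  forall x y, 0 <= x <= t -> 0 <= y <= t -> `|A x - A y| <= M * `|x - y|.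
Proof.
have [c _ cM] := EVT_max (ltW t0) (continuous_subspaceT continuous_expR_path).
exists (f c); first exact: expR_gt0.
suff H x y : 0 <= x -> x <= y -> y <= t -> `|A x - A y| <= f c * `|x - y|.
  move=> x y /andP[x0 xt] /andP[y0 yt]; have [xy|/ltW yx] := leP x y; first exact: H.
  by rewrite distrC (distrC x); exact: H.
move=> x0 xy yt; rewrite distrC (distrC x) !ger0_norm ?subr_ge0// ?Apath_le//.
have fM z : x <= z <= y -> 0 <= f z <= f c.
  move=> /andP[xz zy]; rewrite expR_ge0/= cM// in_itv/=.
  by rewrite (le_trans x0 xz) (le_trans zy yt).
by have /andP[_] := Apath_increment_bounds x y 0 (f c) x0 xy fM; rewrite mulrC.
Qed.

Lemma cvg_mesh_size : t / n.+1%:R @[n --> \oo] --> (0 : R).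
Proof. by rewrite -(mulr0 t); apply: cvgM; [exact: cvg_cst|exact: cvg_harmonic]. Qed.

Lemma mesh_size_lt (r : R) : 0 < r -> \forall n \near \oo, t / n.+1%:R < r.
Proof.
move=> r0; have /cvgrPdist_lt /(_ r r0) := cvg_mesh_size.
apply: filterS => n; rewrite sub0r normrN; apply: le_lt_trans; exact: ler_norm.
Qed.

(** Uniform continuity from compactness of [0, t], expressed through the mesh size. The point y may
    leave [0, t], since phi is continuous on the whole line. *)
Lemma uniform_modulus (e : R) : 0 < e ->
  \forall n \near \oo, forall x y, 0 <= x <= t -> `|x - y| <= t / n.+1%:R ->
    `|phi x - phi y| <= e.
Proof.
move=> e0.
have /compact_near_coveringP cov : compact `[0, t]%classic by exact: segment_compact.
pose Q n x := forall y, `|x - y| <= t / n.+1%:R -> `|phi x - phi y| <= e.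
have loc x : `[0, t]%classic x -> \forall x' \near x & n \near \oo, Q n x'.
  move=> _.
  have /cvgrPdist_le /(_ (e / 2)) : phi z @[z --> x] --> phi x by exact: cphi.
  rewrite divr_gt0// => /(_ isT) [r /= r0 xr].
  have r20 : 0 < r / 2 by rewrite divr_gt0.
  exists (ball x (r / 2), [set n | t / n.+1%:R < r / 2]).
    by split => /=; [exact: nbhsx_ballx|exact: mesh_size_lt].
  move=> [x' n] /= [xx' nr] y x'y.
  have d1 : `|phi x - phi x'| <= e / 2.
    by apply: xr => /=; apply: lt_le_trans xx' _; lra.
  have d2 : `|phi x - phi y| <= e / 2.
    apply: xr => /=; apply: le_lt_trans (ler_distD x' _ _) _.
    by rewrite [ltRHS](splitr r) ltrD// (le_lt_trans x'y).
  apply: le_trans (ler_distD (phi x) _ _) _; rewrite [leRHS](splitr e) lerD//.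
  by rewrite distrC.
have : \forall n \near \oo, `[0, t]%classic `<=` Q n by exact: cov.
by apply: filterS => n H x y x0t; apply: H; rewrite /= in_itv.
Qed.

(** On a cell [a, b] the exponent 2 phi x stays within 2 w of phi a + phi b. The error is therefore
    multiplicative, with the same factor on each cell, and does not grow when the cells are
    added. *)
Lemma area_mesh_bounds (h w : R) (k : nat) : 0 < h -> k%:R * h <= t ->
  (forall x y, 0 <= x <= t -> `|x - y| <= h -> `|phi x - phi y| <= w) ->
  expR (- (2 * w)) * A (k%:R * h) <= area h (mesh_increments phi h k)
    <= expR (2 * w) * A (k%:R * h).
Proof.
move=> h0 kt wphi; elim: k kt => [|k ih] kt; first by rewrite mul0r Apath0 !mulr0 lexx.
have kk : k.+1%:R * h = k%:R * h + h by rewrite -natr1 mulrDl mul1r.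
have kh0 : 0 <= k%:R * h by rewrite mulr_ge0// ltW.
have /ih /andP[ih1 ih2] : k%:R * h <= t by apply: le_trans kt; rewrite kk; lra.
rewrite [mesh_increments _ _ _]/= [area _ _]/= pos_mesh phi0 subr0.
set a := k%:R * h in kh0 kk ih1 ih2 *; set b := k.+1%:R * h in kk kt *.
have -> : 2 * phi a + (phi b - phi a) = phi a + phi b by lra.
set p := phi a + phi b.
have /andP[s1 s2] : (b - a) * expR (p - 2 * w) <= A b - A a <= (b - a) * expR (p + 2 * w).
  apply: Apath_increment_bounds => //; first by lra.
  move=> x /andP[ax xb]; have x0t : 0 <= x <= t by lra.
  have := wphi x a x0t; have := wphi x b x0t.
  rewrite !ler_norml !ler_expR /p => /(_ ltac:(apply/andP; split; lra)) /andP[? ?].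
  by move=> /(_ ltac:(apply/andP; split; lra)) /andP[? ?]; apply/andP; split; lra.
have ba : b - a = h by lra.
rewrite ba in s1 s2; rewrite expRD in s1; rewrite expRD in s2.
have E : expR (2 * w) * expR (- (2 * w)) = 1 by rewrite -expRD subrr expR0.
have e1 := expR_gt0 (2 * w); have e2 := expR_gt0 (- (2 * w)).
have p0 := expR_gt0 p.
move: (expR (2 * w)) (expR (- (2 * w))) (expR p) (A a) (A b) E e1 e2 p0 s1 s2 ih1 ih2.
move=> E1 E2 P Aa Ab E e1 e2 p0 s1 s2 ih1 ih2.
have t1 : E1 * (h * (P * E2)) <= E1 * (Ab - Aa) by rewrite ler_pM2l.
have t2 : E2 * (Ab - Aa) <= E2 * (h * (P * E1)) by rewrite ler_pM2l.
have t1' : E1 * (h * (P * E2)) = h * P by rewrite -[RHS]mulr1 -E; ring.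
have t2' : E2 * (h * (P * E1)) = h * P by rewrite -[RHS]mulr1 -E; ring.
by apply/andP; split; lra.
Qed.

Lemma Apath_gt0 : 0 < A t.
Proof.
have ct := continuous_subspaceT continuous_expR_path.
have [c _ cm] := EVT_min (ltW t0) (ct `[0, t]%classic).
have [C _ cM] := EVT_max (ltW t0) (ct `[0, t]%classic).
have fm x : 0 <= x <= t -> f c <= f x <= f C.
  by move=> x0t; rewrite cm ?cM// in_itv.
have /andP[+ _] := Apath_increment_bounds 0 t _ _ (lexx 0) (ltW t0) fm.
by rewrite subr0 Apath0 subr0; apply: lt_le_trans; rewrite mulr_gt0// expR_gt0.
Qed.

Lemma cvg_area_mesh (k : nat -> nat) (s : R) : 0 <= s <= t ->
  (forall n, (k n)%:R * (t / n.+1%:R) <= t) ->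
  (k n)%:R * (t / n.+1%:R) @[n --> \oo] --> s ->
  area (t / n.+1%:R) (mesh_increments phi (t / n.+1%:R) (k n)) @[n --> \oo] --> A s.
Proof.
move=> s0t kt ks; apply/cvgrPdist_le => e e0.
have At0 := Apath_gt0; have [M M0 MA] := Apath_lipschitz.
(* Half of e pays for the area: exp (2 w) = 1 + r with r A_t = e / 2 bounds its error. The other
   half pays, through the Lipschitz bound, for replacing s by a mesh point. *)
pose r := e / 2 / A t; have r0 : 0 < r by rewrite !divr_gt0.
pose w := ln (1 + r) / 2.
have Ew : expR (2 * w) = 1 + r.
  by rewrite /w mulrC divfK// lnK// posrE addr_gt0.
have w0 : 0 < w by rewrite divr_gt0// ln_gt0// ltrDl.
have eM : 0 < e / 2 / M by rewrite !divr_gt0.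
move/cvgrPdist_le : ks => /(_ _ eM); move: (uniform_modulus _ w0).
apply: filterS2 => n mod_n ks.
set h := t / n.+1%:R in mod_n ks *.
have h0 : 0 < h by rewrite divr_gt0.
have /andP[b1 b2] := area_mesh_bounds h w (k n) h0 (kt n) mod_n.
have kh0 : 0 <= (k n)%:R * h by rewrite mulr_ge0// ltW.
have Akt := Apath_le _ _ kh0 (kt n).
have Ak0 : 0 <= A ((k n)%:R * h) by rewrite -Apath0; exact: Apath_le.
have lip := MA s ((k n)%:R * h) s0t; rewrite kh0 kt in lip.
have {}lip : `|A s - A ((k n)%:R * h)| <= e / 2.
  by apply: le_trans (lip isT) _; rewrite mulrC -ler_pdivlMr.
apply: le_trans (ler_distD (A ((k n)%:R * h)) _ _) _.
rewrite [leRHS](splitr e) lerD//.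
rewrite Ew in b2; rewrite expRN Ew in b1.
have rA : r * A t = e / 2 by rewrite /r divfK// gt_eqF.
have inv : 1 - r <= (1 + r)^-1.
  rewrite -[leRHS]mul1r ler_pdivlMr ?addr_gt0//; have := sqr_ge0 r; lra.
move: inv b1 b2 Ak0 Akt rA; move: (A ((k n)%:R * h)) (A t) ((1 + r)^-1) => X Y I inv b1 b2 Ak0 Akt rA.
have rX : r * X <= e / 2 by rewrite -rA ler_pM2l.
have iX : (1 - r) * X <= I * X by rewrite ler_wpM2r.
by rewrite ler_norml; apply/andP; split; lra.
Qed.

Definition mesh_index (s : R) (n : nat) : nat := Num.truncn (s / (t / n.+1%:R)).

Lemma mesh_index_bounds s n : 0 <= s <= t ->
  [/\ (mesh_index s n <= n.+1)%N, (mesh_index s n)%:R * (t / n.+1%:R) <= s &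
      s <= (mesh_index s n)%:R * (t / n.+1%:R) + t / n.+1%:R].
Proof.
move=> /andP[s0 st]; have h0 : 0 < t / n.+1%:R by rewrite divr_gt0.
have x0 : 0 <= s / (t / n.+1%:R) by rewrite divr_ge0// ltW.
have /andP[k1 k2] := truncn_itv x0.
rewrite -/(mesh_index s n) in k1 k2.
have k3 : (mesh_index s n)%:R * (t / n.+1%:R) <= s by rewrite -ler_pdivlMr.
split=> //.
  rewrite -(ler_nat R) -(ler_pM2r h0); apply: le_trans k3 _.
  by rewrite mulrC divfK.
by move: k2; rewrite ltr_pdivrMr// -natr1 mulrDl mul1r => /ltW.
Qed.

Lemma cvg_mesh_index s : 0 <= s <= t ->
  (mesh_index s n)%:R * (t / n.+1%:R) @[n --> \oo] --> s.
Proof.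
move=> s0t; apply/cvgrPdist_le => e e0; apply: filterS (mesh_size_lt e e0) => n ne.
have [_ k1 k2] := mesh_index_bounds s n s0t.
by rewrite ger0_norm ?subr_ge0// lerBlDl (le_trans k2)// lerD2l ltW.
Qed.

Lemma cvg_pos_mesh s : 0 <= s <= t ->
  pos (drop (n.+1 - mesh_index s n) (mesh_increments phi (t / n.+1%:R) n.+1))
    @[n --> \oo] --> phi s.
Proof.
move=> s0t.
have -> : (fun n => pos (drop (n.+1 - mesh_index s n)
    (mesh_increments phi (t / n.+1%:R) n.+1))) =
  (fun n => phi ((mesh_index s n)%:R * (t / n.+1%:R))).
  apply/funext => n; have [kn _ _] := mesh_index_bounds s n s0t.
  by rewrite drop_mesh// pos_mesh phi0 subr0.
exact: cvg_comp (cvg_mesh_index s s0t) (cphi s).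
Qed.

Lemma cvg_pos_reflect_mesh s : 0 <= s <= t ->
  pos (drop (n.+1 - mesh_index s n)
    (reflect (t / n.+1%:R) (mesh_increments phi (t / n.+1%:R) n.+1)))
    @[n --> \oo] --> calT t phi s.
Proof.
move=> s0t; have tt n : n.+1%:R * (t / n.+1%:R) = t by rewrite mulrC divfK.
have At0 := Apath_gt0.
pose a n := area (t / n.+1%:R) (mesh_increments phi (t / n.+1%:R) (mesh_index s n)).
pose b n := area (t / n.+1%:R) (mesh_increments phi (t / n.+1%:R) n.+1).
have ca : a n @[n --> \oo] --> A s.
  apply: cvg_area_mesh => //; last exact: cvg_mesh_index.
  move=> n; have [_ k1 _] := mesh_index_bounds s n s0t.
  by apply: le_trans k1 _; case/andP: s0t.
have cb : b n @[n --> \oo] --> A t.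
  apply: (cvg_area_mesh S); first by rewrite lexx ltW.
    by move=> n; rewrite tt.
  by under eq_fun do rewrite tt; exact: cvg_cst.
have -> : (fun n => pos (drop (n.+1 - mesh_index s n)
    (reflect (t / n.+1%:R) (mesh_increments phi (t / n.+1%:R) n.+1)))) =
  (fun n => phi ((mesh_index s n)%:R * (t / n.+1%:R)) -
     ln (1 + (expR (2 * phi t) - 1) / b n * a n)).
  apply/funext => n; have [kn _ _] := mesh_index_bounds s n s0t.
  rewrite /reflect drop_rebase drop_mesh// pos_rebase !pos_mesh phi0 !subr0 tt.
  by [].
rewrite /calT /Tz; apply: cvgB.
  exact: cvg_comp (cvg_mesh_index s s0t) (cphi s).
have -> : A s / A t * (expR (2 * phi t) - 1) = (expR (2 * phi t) - 1) / A t * A s by ring.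
apply: continuous_cvg.
  (* The argument of ln is positive, being a convex combination of 1 and exp (2 phi t) with weight
     A_s / A_t in [0, 1]. *)
  apply: continuous_ln; case/andP: s0t => s0 st.
  have r0 : 0 <= A s / A t by rewrite divr_ge0 ?(ltW At0)// -Apath0 Apath_le.
  have r1 : A s / A t <= 1 by rewrite ler_pdivrMr// mul1r Apath_le.
  rewrite (_ : _ / A t * A s = A s / A t * (expR (2 * phi t) - 1)); last by ring.
  have := expR_gt0 (2 * phi t); move: (A s / A t) (expR _) r0 r1 => x E; nra.
apply: cvgD; first exact: cvg_cst.
apply: cvgM => //; apply: cvgM; first exact: cvg_cst.
by apply: cvgV => //; rewrite gt_eqF.
Qed.

End MeshPaths.

(** * Equality of laws from continuous test functions *)

Section LawFromTestFunctions.
Context {R : realType} {d : measure_display} {Omega : measurableType d}.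
Variable P : probability Omega R.

Lemma bounded_cvg_Rintegral (f_ : nat -> Omega -> R) (f : Omega -> R) :
  (forall n, measurable_fun setT (f_ n)) -> measurable_fun setT f ->
  (forall n w, `|f_ n w| <= 1) -> (forall w, `|f w| <= 1) ->
  (forall w, f_ n w @[n --> \oo] --> f w) ->
  (\int[P]_w f_ n w)%R @[n --> \oo] --> (\int[P]_w f w)%R.
Proof.
move=> mf_ mf f_1 f1 ff; apply: fine_cvg; rewrite (@EFin_Rintegral _ _ _ P _ 1)//.
have i1 := finite_measure_integrable_cst P 1 measurableT.
apply: (dominated_cvg measurableT _ _ _ i1) => //.
- by move=> n; exact/measurable_EFinP.
- by move=> w _; apply: cvg_EFin; [exact: nearW|exact: ff].
- by move=> n w _; rewrite /= lee_fin; exact: f_1.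
Qed.

(** Continuous [0, 1]-valued approximations of the indicator of an open ray; such rays form a
    pi-system generating the Borel sets. *)
Definition ramp (a : R) (m : nat) (x : R) : R := Num.min 1 (Num.max 0 (m%:R * (x - a))).

Lemma ramp_bounds a m x : 0 <= ramp a m x <= 1.
Proof. by rewrite /ramp le_min ler01/= le_max lexx/= ge_min lexx. Qed.

Lemma continuous_ramp a m : continuous (ramp a m).
Proof.
move=> x.
have cl : {for x, continuous (fun y : R => m%:R * (y - a) : R^o)}.
  apply: cvgM; first exact: cvg_cst.
  by apply: cvgB; [exact: cvg_id|exact: cvg_cst].
have c0 : {for x, continuous (cst 0 : R -> R^o)} by exact: cvg_cst.
have c1 : {for x, continuous (cst 1 : R -> R^o)} by exact: cvg_cst.
exact: (continuous_min c1 (continuous_max c0 cl)).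
Qed.

Lemma cvg_ramp a x : ramp a m x @[m --> \oo] --> (\1_(`]a, +oo[%classic : set R) x : R).
Proof.
rewrite indicE /=; have [xa|xa] := leP x a.
  rewrite memNset/=; last by rewrite in_itv/= andbT => /(le_lt_trans xa); rewrite ltxx.
  under eq_fun => m.
    rewrite /ramp (_ : Num.max _ _ = 0); last by rewrite max_l// mulr_ge0_le0// subr_le0.
    by rewrite min_r//; over.
  exact: cvg_cst.
rewrite mem_set/=; last by rewrite in_itv/= andbT.
have xa0 : 0 < x - a by rewrite subr_gt0.
apply: cvg_near_cst; apply: filterS (nbhs_infty_ger (x - a)^-1) => m.
rewrite -[X in X <= _]mul1r ler_pdivrMr// => m1.
by rewrite /ramp max_r ?(le_trans ler01)// min_l.
Qed.

Lemma prod01 (I : Type) (r : seq I) (F : I -> R) :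
  (forall i, 0 <= F i <= 1) -> 0 <= \prod_(i <- r) F i <= 1.
Proof.
move=> F01; elim: r => [|i r /andP[p0 p1]]; first by rewrite big_nil ler01 lexx.
have /andP[f0 f1] := F01 i; rewrite big_cons mulr_ge0//=; exact: mulr_ile1.
Qed.

Lemma norm_le1 (x : R) : 0 <= x <= 1 -> `|x| <= 1.
Proof. by move=> /andP[x0 x1]; rewrite ger0_norm. Qed.

Lemma cvg_prod (I : Type) (r : seq I) (F_ : nat -> I -> R) (F : I -> R) :
  (forall i, F_ n i @[n --> \oo] --> F i) ->
  \prod_(i <- r) F_ n i @[n --> \oo] --> \prod_(i <- r) F i.
Proof.
move=> FF; elim: r => [|i r ih].
  by under eq_fun do rewrite big_nil; rewrite big_nil; exact: cvg_cst.
by under eq_fun do rewrite big_cons; rewrite big_cons; exact: cvgM.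
Qed.

Lemma measurable_prod (I : Type) (r : seq I) (F : I -> Omega -> R) :
  (forall i, measurable_fun setT (F i)) ->
  measurable_fun setT (fun w => \prod_(i <- r) F i w).
Proof.
move=> mF; elim: r => [|i r ih].
  by under eq_fun do rewrite big_nil; exact: measurable_cst.
by under eq_fun do rewrite big_cons; exact: measurable_funM.
Qed.

Lemma indic_bigcap n (A : nat -> set Omega) w :
  \1_(\bigcap_(i in `I_n) A i) w = \prod_(i < n) \1_(A i) w :> R.
Proof.
rewrite indicE; have [wA|wA] := boolP (w \in _).
  rewrite big1// => i _; rewrite indicE mem_set//.
  by move: wA; rewrite inE => /(_ i); apply; exact: (ltn_ord i).
have [i Ai] : exists i : 'I_n, w \notin A i.
  apply/not_existsP => H; move/negP: wA; apply; rewrite inE => i /= i_n.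
  by have /negP := H (Ordinal i_n); rewrite negbK inE.
by rewrite (bigD1 i)//= indicE (negbTE Ai) mul0r.
Qed.

Lemma P_bigcap n (X : nat -> Omega -> R) (A : nat -> set R) :
  (forall i, measurable_fun setT (X i)) -> (forall i, measurable (A i)) ->
  P (\bigcap_(i in `I_n) [set w | A i (X i w)]) =
  ((\int[P]_w (\prod_(i < n) \1_(A i) (X i w)))%R)%:E.
Proof.
move=> mX mA.
have i01 (B : set R) x : 0 <= (\1_B x : R) <= 1.
  by rewrite indicE; case: (_ \in _); rewrite lexx ler01.
rewrite (@EFin_Rintegral _ _ _ P _ 1).
- under eq_integral => w _.
    rewrite (eq_bigr (fun i : 'I_n => \1_([set w | A i (X i w)]) w)); last first.
      by move=> i _; rewrite !indicE.
    rewrite -(indic_bigcap n (fun i => [set w | A i (X i w)])).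
    over.
  rewrite integral_indic// ?setIT//; apply: bigcap_measurableType => i _.
  by rewrite -[X in measurable X]setTI; exact: mX.
- apply: measurable_prod => i.
  have mi : measurable_fun setT (\1_(A i) : R -> R) by exact: measurable_indic.
  exact: measurableT_comp mi (mX i).
- by move=> w; apply: norm_le1; exact: prod01.
Qed.

Variables (n : nat) (X Y : nat -> Omega -> R).
Hypotheses (mX : forall i, measurable_fun setT (X i))
  (mY : forall i, measurable_fun setT (Y i)).
Hypothesis XY : forall g : nat -> R -> R,
  (forall i, continuous (g i)) -> (forall i x, 0 <= g i x <= 1) ->
  (\int[P]_w (\prod_(i < n) g i (X i w)))%R = (\int[P]_w (\prod_(i < n) g i (Y i w)))%R.

Lemma cvg_expectation_ramp (Z : nat -> Omega -> R) (a : nat -> R) :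
  (forall i, measurable_fun setT (Z i)) ->
  (\int[P]_w (\prod_(i < n) ramp (a i) m (Z i w)))%R @[m --> \oo] -->
  (\int[P]_w (\prod_(i < n) \1_(`]a i, +oo[%classic : set R) (Z i w)))%R.
Proof.
move=> mZ; have i01 (B : set R) x : 0 <= (\1_B x : R) <= 1.
  by rewrite indicE; case: (_ \in _); rewrite lexx ler01.
apply: bounded_cvg_Rintegral.
- move=> m; apply: measurable_prod => i.
  apply: measurableT_comp => //; apply: continuous_measurable_fun.
  exact: continuous_ramp.
- apply: measurable_prod => i; apply: measurableT_comp => //.
- by move=> m w; apply: norm_le1; apply: prod01 => i; exact: ramp_bounds.
- by move=> w; apply: norm_le1; exact: prod01.
- move=> w; apply: (cvg_prod _ _ (fun m (i : 'I_n) => ramp (a i) m (Z i w))) => i.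
  exact: cvg_ramp.
Qed.

Lemma eq_law_rays (a : nat -> R) :
  P (\bigcap_(i in `I_n) [set w | `]a i, +oo[%classic (X i w)]) =
  P (\bigcap_(i in `I_n) [set w | `]a i, +oo[%classic (Y i w)]).
Proof.
rewrite (P_bigcap n X (fun i => `]a i, +oo[%classic))//.
rewrite (P_bigcap n Y (fun i => `]a i, +oo[%classic))//; congr EFin.
have E m : (\int[P]_w (\prod_(i < n) ramp (a i) m (X i w)))%R =
    (\int[P]_w (\prod_(i < n) ramp (a i) m (Y i w)))%R.
  apply: (XY (fun i => ramp (a i) m)) => i; first exact: continuous_ramp.
  exact: ramp_bounds.
have cX := cvg_expectation_ramp X a mX; have cY := cvg_expectation_ramp Y a mY.
rewrite (eq_cvg _ _ E) in cX; exact: (cvg_unique _ cX cY).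
Qed.

Let rays : set (set R) := [set B | exists a, B = `]a, +oo[%classic].

Let setI_closed_rays : setI_closed rays.
Proof.
move=> _ _ [a ->] [b ->]; exists (Num.max a b); apply/seteqP; split => x /=;
  rewrite !in_itv/= !andbT gt_max => /andP //.
Qed.

(** Rays are replaced by arbitrary measurable sets one coordinate at a time: in H the first k sets
    are arbitrary and the others are rays. *)
Lemma eq_law_measurable (A : nat -> set R) : (forall i, measurable (A i)) ->
  P (\bigcap_(i in `I_n) [set w | A i (X i w)]) =
  P (\bigcap_(i in `I_n) [set w | A i (Y i w)]).
Proof.
move=> mA.
suff H k (B : nat -> set R) : (forall i, measurable (B i)) ->
    (forall i, (k <= i)%N -> rays (B i)) ->
    P (\bigcap_(i in `I_n) [set w | B i (X i w)]) =
    P (\bigcap_(i in `I_n) [set w | B i (Y i w)]).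
  (* H with k = n asks for rays at every index from n on; any ray will do there, as the
     intersections stop before n. *)
  pose B i := if (i < n)%N then A i else `]0, +oo[%classic.
  have BA (Z : nat -> Omega -> R) : \bigcap_(i in `I_n) [set w | A i (Z i w)] =
      \bigcap_(i in `I_n) [set w | B i (Z i w)].
    by apply: eq_bigcapr => i /= i_n; rewrite /B i_n.
  rewrite !BA; apply: (H n) => i; rewrite /B; first by case: ifP.
  by rewrite ltnNge => -> /=; exists 0.
elim: k B => [B _ rB|k ih B mB rB].
  have rB' i : exists a, B i = `]a, +oo[%classic by exact: rB.
  have [a Ba] := choice rB'.
  have -> : B = fun i => `]a i, +oo[%classic by apply/funext.
  exact: eq_law_rays.
pose C Z k' i : set Omega := if i == k' then setT else [set w : Omega | B i (Z i w)].
(* If k >= n the k-th set does not enter the intersections, and padding with rays from n on brings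
   the induction hypothesis into play. *)
have [kn|nk] := ltnP k n; last first.
  pose B' i := if (i < n)%N then B i else `]0, +oo[%classic.
  have BB (Z : nat -> Omega -> R) : \bigcap_(i in `I_n) [set w | B i (Z i w)] =
      \bigcap_(i in `I_n) [set w | B' i (Z i w)].
    by apply: eq_bigcapr => i /= i_n; rewrite /B' i_n.
  rewrite !BB; apply: ih => i; rewrite /B'; first by case: ifP.
  by move=> ki; rewrite ltnNge (leq_trans nk ki) /=; exists 0.
pose D (Z : nat -> Omega -> R) := \bigcap_(i in `I_n) C Z k i.
have mD (Z : nat -> Omega -> R) : (forall i, measurable_fun setT (Z i)) -> measurable (D Z).
  move=> mZ; apply: bigcap_measurableType => i _; rewrite /C; case: ifP => // _.
  by rewrite -[X in measurable X]setTI; exact: mZ.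
have DE (Z : nat -> Omega -> R) (E : set R) : (Z k @^-1` E) `&` D Z =
    \bigcap_(i in `I_n) [set w | (if i == k then E else B i) (Z i w)].
  apply/seteqP; split => [w [Ew Dw] i /= i_n|w /= H].
    case: eqP => [->//|/eqP ik]; have := Dw i i_n; rewrite /C (negbTE ik).
    exact.
  split; first by have := H k kn; rewrite eqxx.
  move=> i /= i_n; rewrite /C; case: eqP => [//|/eqP ik].
  by have := H i i_n; rewrite (negbTE ik).
have BE (Z : nat -> Omega -> R) : \bigcap_(i in `I_n) [set w | B i (Z i w)] =
    (Z k @^-1` (B k)) `&` D Z.
  by rewrite DE; apply: eq_bigcapr => i _; case: eqP => [->|].
rewrite !BE.
have mXk : measurable_fun setT (X k : Omega -> measurableTypeR R) by exact: mX.
have mYk : measurable_fun setT (Y k : Omega -> measurableTypeR R) by exact: mY.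
(* With the constraints on the other coordinates frozen in D, the k-th coordinate has a finite law.
   Putting a ray in place k leaves only the first k sets arbitrary, so the induction hypothesis
   makes the two laws agree on rays. *)
pose muX' : {measure set (measurableTypeR R) -> \bar R} :=
  pushforward (mrestr P (mD X mX)) (X k : Omega -> measurableTypeR R).
pose muY' : {measure set (measurableTypeR R) -> \bar R} :=
  pushforward (mrestr P (mD Y mY)) (Y k : Omega -> measurableTypeR R).
pose muX := muX' mXk; pose muY := muY' mYk.
have mrays : @measurable _ (measurableTypeR R) = <<s rays >>.
  exact: (RGenOInfty.measurableE R).
have raysm m : rays `](- m%:R), +oo[%classic by exists (- m%:R).
have cover : \bigcup_m `](- m%:R : R), +oo[%classic = setT.
  rewrite -subTset => x _; exists (Num.truncn `|x|).+1 => //=.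
  rewrite in_itv/= andbT ltrNl; apply: le_lt_trans (ler_norm _) _; rewrite normrN.
  exact: truncnS_gt.
have eq_rays E : rays E -> muX E = muY E.
  move=> [a ->]; change (P ((X k @^-1` `]a, +oo[%classic) `&` D X) =
    P ((Y k @^-1` `]a, +oo[%classic) `&` D Y)).
  rewrite !DE; apply: (ih (fun i => if i == k then `]a, +oo[%classic else B i)) => i; first by case: eqP.
  move=> ki; case: eqP => [_|/eqP ik]; first by exists a.
  by apply: rB; rewrite ltn_neqAle eq_sym ik.
have finX m : (muX `](- m%:R)%R, +oo[%classic < +oo)%E.
  apply: le_lt_trans (probability_le1 P _) (ltry 1).
  by apply: measurableI; [rewrite -[X in measurable X]setTI; exact: mX|exact: (mD X mX)].
exact: (@measure_unique _ R (measurableTypeR R) rays _ mrays setI_closed_rays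
  raysm cover muX muY eq_rays finX (B k) (mB k)).
Qed.

End LawFromTestFunctions.

(** * Passage to the limit for Brownian motion *)

Section Assembly.
Context {R : realType} {d : measure_display} {Omega : measurableType d}.
Variables (P : probability Omega R) (B : R -> Omega -> R) (t : R).
Hypotheses (BM : is_brownian_motion P B) (t0 : 0 < t).

Definition mesh_increment (h : R) (i : nat) (w : Omega) : R :=
  B (i.+1%:R * h) w - B (i%:R * h) w.

Lemma measurable_brownian s : 0 <= s -> measurable_fun setT (B s).
Proof. by case: BM => mB _ _ _; exact: mB. Qed.

Lemma measurable_mesh_increment h i : 0 < h ->
  measurable_fun setT (mesh_increment h i).
Proof.
by move=> h0; apply: measurable_funB; apply: measurable_brownian; rewrite mulr_ge0// ltW.
Qed.

Lemma indep_mesh_increment h : 0 < h -> forall (n : nat) (A : nat -> set R),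
  (forall i, measurable (A i)) ->
  P (\bigcap_(i in `I_n) [set w | A i (mesh_increment h i w)]) =
  (\prod_(i < n) fine (normal_prob 0 (Num.sqrt h) (A i)))%:E.
Proof.
move=> h0 n A mA; case: BM => _ _ _ indep.
have E i : i.+1%:R * h - i%:R * h = h by rewrite -natr1 mulrDl mul1r addrAC subrr add0r.
apply: etrans (indep n (fun i => i%:R * h) A _ _ mA) _.
- by rewrite mul0r.
- by move=> i _; rewrite ltr_pM2r// ltr_nat.
- apply: (congr1 EFin).
  apply: eq_bigr => i _.
  exact: (congr1 (fun r => fine (normal_prob 0 (Num.sqrt r) (A i))) (E i)).
Qed.

(* Continuous on the whole line, unlike the path itself, whose values at
   negative times are arbitrary. *)
Definition brownian_path (w : Omega) (u : R) : R := B (Num.max u 0) w.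

Lemma brownian_pathE w u : 0 <= u -> brownian_path w u = B u w.
Proof. by move=> u0; rewrite /brownian_path max_l. Qed.

Lemma brownian_path0 w : brownian_path w 0 = 0.
Proof. by rewrite brownian_pathE//; case: BM. Qed.

Lemma continuous_brownian_path w : continuous (brownian_path w).
Proof.
case: BM => _ _ /(_ w) /subspace_continuousP cB _ x.
have cmax : Num.max u 0 @[u --> x] --> (Num.max x 0 : R).
  have c0 : {for x, continuous (cst 0 : R -> R^o)} by exact: cvg_cst.
  have c1 : {for x, continuous (id : R -> R^o)} by exact: cvg_id.
  exact: (continuous_max c1 c0).
have m0 u : `[0, +oo[%classic (Num.max u 0 : R).
  by rewrite /= in_itv/= andbT le_max lexx orbT.
have cw : Num.max u 0 @[u --> x] --> within `[0, +oo[%classic (nbhs (Num.max x 0 : R)).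
  move=> U UW.
  have {}UW : \forall u \near x, `[0, +oo[%classic (Num.max u 0 : R) -> U (Num.max u 0).
    exact: cmax _ UW.
  by apply: filterS UW => u; apply; exact: m0.
exact: cvg_comp cw (cB _ (m0 x)).
Qed.

Lemma rev_increments_mesh h k w : 0 < h ->
  rev_increments (mesh_increment h) k w = mesh_increments (brownian_path w) h k.
Proof.
move=> h0; elim: k => //= k ->; congr (_ :: _).
by rewrite /mesh_increment !brownian_pathE// mulr_ge0// ltW.
Qed.

Lemma calT_brownian_path w s : 0 <= s <= t ->
  calT t (fun u => B u w) s = calT t (brownian_path w) s.
Proof.
move=> /andP[s0 st].
have AE r : Apath (fun u => B u w) r = Apath (brownian_path w) r.
  apply: eq_Rintegral => u; rewrite inE/= in_itv/= => /andP[u0 _].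
  by rewrite brownian_pathE.
by rewrite /calT /Tz !AE !brownian_pathE// ltW.
Qed.

Notation h n := (t / n.+1%:R).
Notation V n := (rev_increments (mesh_increment (h n)) n.+1).

Lemma mesh_size_gt0 n : 0 < h n.
Proof. by rewrite divr_gt0. Qed.

Lemma mseq_drop d' (T : measurableType d') k n (s : T -> seq R) :
  mseq n s -> mseq (n - k) (fun w => drop k (s w)).
Proof.
case=> ss ms; split => [w|i]; first by rewrite size_drop ss.
by under eq_fun do rewrite nth_drop; exact: ms.
Qed.

Lemma mseq_mesh_increments n : mseq n.+1 (V n).
Proof.
apply: (mseq_rev_increments (mesh_increment (h n))) => i.
exact: measurable_mesh_increment (mesh_size_gt0 n).
Qed.

Lemma measurable_mesh_pos s n :
  measurable_fun setT (fun w => pos (drop (n.+1 - mesh_index t s n) (V n w))).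
Proof.
exact: measurable_pos (mseq_drop _ _ _ _ _ (mseq_mesh_increments n)).
Qed.

Lemma measurable_mesh_pos_reflect s n :
  measurable_fun setT
    (fun w => pos (drop (n.+1 - mesh_index t s n) (reflect (h n) (V n w)))).
Proof.
have mT := mseq_reflect (h n) (mesh_size_gt0 n) _ _ _ _ (mseq_mesh_increments n).
exact: measurable_pos (mseq_drop _ _ _ _ _ mT).
Qed.

Lemma cvg_mesh_brownian s w : 0 <= s <= t ->
  pos (drop (n.+1 - mesh_index t s n) (V n w)) @[n --> \oo] --> B s w.
Proof.
move=> s0t; under eq_fun => n do rewrite rev_increments_mesh ?mesh_size_gt0//.
rewrite -brownian_pathE; last by case/andP: s0t.
apply: cvg_pos_mesh => //; first exact: continuous_brownian_path.
exact: brownian_path0.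
Qed.

Lemma cvg_mesh_reflect_brownian s w : 0 <= s <= t ->
  pos (drop (n.+1 - mesh_index t s n) (reflect (h n) (V n w))) @[n --> \oo] -->
  calT t (fun u => B u w) s.
Proof.
move=> s0t; under eq_fun => n do rewrite rev_increments_mesh ?mesh_size_gt0//.
rewrite calT_brownian_path//.
apply: cvg_pos_reflect_mesh => //; first exact: continuous_brownian_path.
exact: brownian_path0.
Qed.

(** [calT] involves integrals along the path; its measurability in w is inherited from the discrete
    approximations. *)
Lemma measurable_calT_brownian s : 0 <= s <= t ->
  measurable_fun setT (fun w => calT t (fun u => B u w) s).
Proof.
move=> s0t; apply: (measurable_fun_cvg (measurable_mesh_pos_reflect s)) => w _.
exact: cvg_mesh_reflect_brownian.
Qed.

Lemma eq_expectation_calT n (ss : nat -> R) (g : nat -> R -> R) :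
  (forall i, 0 <= ss i <= t) ->
  (forall i, continuous (g i)) -> (forall i x, 0 <= g i x <= 1) ->
  (\int[P]_w (\prod_(i < n) g i (calT t (fun u => B u w) (ss i))))%R =
  (\int[P]_w (\prod_(i < n) g i (B (ss i) w)))%R.
Proof.
move=> ss0t cg g01.
pose F m (v : seq R) := \prod_(i < n) g i (pos (drop (m.+1 - mesh_index t (ss i) m) v)).
have F01 m v : 0 <= F m v <= 1 by apply: prod01.
have mg i : measurable_fun setT (g i) by exact: continuous_measurable_fun.
have mF m k : seqmeas k (F m).
  move=> dT T s ms; apply: measurable_prod => i.
  apply: (measurableT_comp (mg i)); apply: measurable_pos; exact: mseq_drop ms.
have lim1 : (\int[P]_w F m (reflect (h m) (V m w)))%R @[m --> \oo] -->
    (\int[P]_w (\prod_(i < n) g i (calT t (fun u => B u w) (ss i))))%R.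
  apply: bounded_cvg_Rintegral.
  - move=> m; apply: measurable_prod => i.
    exact: measurableT_comp (mg i) (measurable_mesh_pos_reflect (ss i) m).
  - apply: measurable_prod => i.
    exact: measurableT_comp (mg i) (measurable_calT_brownian _ (ss0t i)).
  - by move=> m w; exact: norm_le1.
  - by move=> w; apply: norm_le1; exact: prod01.
  - move=> w; apply: (cvg_prod _ _ (fun m (i : 'I_n) =>
      g i (pos (drop (m.+1 - mesh_index t (ss i) m) (reflect (h m) (V m w)))))) => i.
    exact: cvg_comp (cvg_mesh_reflect_brownian _ w (ss0t i)) (cg i _).
have lim2 : (\int[P]_w F m (V m w))%R @[m --> \oo] -->
    (\int[P]_w (\prod_(i < n) g i (B (ss i) w)))%R.
  apply: bounded_cvg_Rintegral.
  - move=> m; apply: measurable_prod => i.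
    exact: measurableT_comp (mg i) (measurable_mesh_pos (ss i) m).
  - apply: measurable_prod => i; apply: (measurableT_comp (mg i)).
    by apply: measurable_brownian; case/andP: (ss0t i).
  - by move=> m w; exact: norm_le1.
  - by move=> w; apply: norm_le1; exact: prod01.
  - move=> w; apply: (cvg_prod _ _ (fun m (i : 'I_n) =>
      g i (pos (drop (m.+1 - mesh_index t (ss i) m) (V m w))))) => i.
    exact: cvg_comp (cvg_mesh_brownian _ w (ss0t i)) (cg i _).
set C := @defect_cst R.
have C0 : 0 <= C by exact: defect_cst_ge0.
have close e : 0 < e -> \forall m \near \oo,
    `|(\int[P]_w F m (reflect (h m) (V m w)))%R - (\int[P]_w F m (V m w))%R| <=
    e + (expR (h m * (8 * t * C ^+ 2)) - 1) / e.
  (* Below this mesh size 2 h C <= 1 / 2, which gives the mean likelihood the lower bound 1 / 2. *)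
  move=> e0; have r0 : 0 < (4 * (C + 1))^-1 by rewrite invr_gt0 mulr_gt0// ltr_wpDl.
  apply: filterS2 (mesh_size_lt t _ ltr01) (mesh_size_lt t _ r0) => m m1 mr.
  have h0 := mesh_size_gt0 m.
  have q12 : 2^-1 <= mean_likelihood (h m).
    have := one_sub_mean_likelihood (h m) h0 (ltW m1).
    have : h m * (4 * (C + 1)) < 1 by rewrite -ltr_pdivlMr ?mul1r// mulr_gt0// ltr_wpDl.
    rewrite -/C; move: (h m) (mean_likelihood _) h0 => x q x0; nra.
  (* Since (m + 1) h = t, the m + 1 variances of order h^2 add up to order h. *)
  have -> : h m * (8 * t * C ^+ 2) = m.+1%:R * (8 * (h m * C) ^+ 2).
    by field; rewrite addrC natr1 pnatr_eq0.
  apply: reflect_expectation_close => //; first exact: ltW.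
  - by move=> i; exact: measurable_mesh_increment.
  - exact: indep_mesh_increment.
have small e : 0 < e -> e + (expR (h m * (8 * t * C ^+ 2)) - 1) / e @[m --> \oo] --> e.
  move=> e0; rewrite -[X in _ --> X]addr0; apply: cvgD; first exact: cvg_cst.
  rewrite -(mul0r e^-1); apply: cvgM; last exact: cvg_cst.
  rewrite -(subrr (1 : R)); apply: cvgB; last exact: cvg_cst.
  have c1 : h m * (8 * t * C ^+ 2) @[m --> \oo] --> 0 * (8 * t * C ^+ 2).
    by apply: cvgM; [exact: cvg_mesh_size|exact: cvg_cst].
  rewrite mul0r in c1; have c2 := cvg_comp _ _ c1 (@continuous_expR R 0).
  by rewrite expR0 in c2.
(* The mesh is refined with e fixed, which bounds the distance of the two limits by e; then e is
   arbitrary. *)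
apply/eqP; rewrite -subr_eq0 -normr_le0; apply/ler_addgt0Pl => e e0; rewrite addr0.
apply: (ler_cvg_to _ (small e e0) (close e e0)).
exact: cvg_norm (cvgB lim1 lim2).
Qed.

End Assembly.

Theorem theorem1p1 (R : realType) (d : measure_display) (Omega : measurableType d)
    (P : probability Omega R) (B : R -> Omega -> R) (t : R) :
  is_brownian_motion P B -> 0 < t ->
  eq_law_on P t (fun s w => calT t (fun u => B u w) s) B.
Proof.
move=> BM t0 n ss A ss0t mA.
(* The times are only known to lie in [0, t] below n, while measurability is wanted at every index;
   0 fills the remaining places. *)
pose rr i := if (i < n)%N then ss i else 0.
have rr0t i : 0 <= rr i <= t.
  by rewrite /rr; case: ifP => [/ss0t//|_]; rewrite lexx ltW.
have E (Z : R -> Omega -> R) : \bigcap_(i in `I_n) [set w | A i (Z (ss i) w)] =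
    \bigcap_(i in `I_n) [set w | A i (Z (rr i) w)].
  by apply: eq_bigcapr => i /= i_n; rewrite /rr i_n.
rewrite (E (fun s w => calT t (fun u => B u w) s)) (E B).
apply: (eq_law_measurable P n (fun i w => calT t (fun u => B u w) (rr i))
  (fun i w => B (rr i) w)) => //.
- by move=> i; exact: (measurable_calT_brownian P B t BM t0 _ (rr0t i)).
- by move=> i; case/andP: (rr0t i) => ? _; case: BM => mB _ _ _; exact: mB.
- by move=> g cg g01; exact: (eq_expectation_calT P B t BM t0).
Qed.
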